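(* There exists an AF C$^*$-algebra $\mathfrak{A}$ and a C$^*$-subalgebra $\mathfrak{D}$ of $\mathfrak{A}$ such that $\mathfrak{D}$ has a (norm) dense subalgebra consisting entirely of nilpotent operators.
   Context: An AF C$^*$-algebra is the norm closure of the union of an increasing sequence of finite dimensional C$^*$-subalgebras. A subalgebra need not be closed nor self-adjoint. *)

(* Defs.v *)
From HB Require Import structures.
From mathcomp Require Import all_boot all_order all_algebra.
From mathcomp Require Import complex.
From mathcomp Require Import all_classical all_reals all_analysis.

Set Implicit Arguments.
Unset Strict Implicit.
Unset Printing Implicit Defensive.

Import Order.TTheory GRing.Theory Num.Theory.
Import numFieldNormedType.Exports.

Local Open Scope classical_set_scope.
Local Open Scope ring_scope.
Local Open Scope complex_scope.

(* The product is a separate operation because C*-algebras need not have a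
   unit, whereas MathComp rings do.  The norm takes its values in R[i], in
   which x <= y forces y - x to be a nonnegative real. *)
HB.mixin Record isCStarAlgebra (R : realType) A
    of CompleteNormedModule R[i] A := {
  cmul : A -> A -> A;
  cstar : A -> A;
  cmulA : forall x y z : A, cmul x (cmul y z) = cmul (cmul x y) z;
  cmulDl : forall x y z : A, cmul (x + y) z = cmul x z + cmul y z;
  cmulDr : forall x y z : A, cmul x (y + z) = cmul x y + cmul x z;
  cmulZl : forall (c : R[i]) (x y : A), cmul (c *: x) y = c *: cmul x y;
  cmulZr : forall (c : R[i]) (x y : A), cmul x (c *: y) = c *: cmul x y;
  cnormM : forall x y : A, `|cmul x y| <= `|x| * `|y|;
  cstarK : forall x : A, cstar (cstar x) = x;
  cstarD : forall x y : A, cstar (x + y) = cstar x + cstar y;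
  cstarZ : forall (c : R[i]) (x : A), cstar (c *: x) = Num.conj c *: cstar x;
  cstarM : forall x y : A, cstar (cmul x y) = cmul (cstar y) (cstar x);
  cnorm_starM : forall x : A, `|cmul (cstar x) x| = `|x| ^+ 2
}.

#[short(type="cstarAlgType")]
HB.structure Definition CStarAlgebra (R : realType) :=
  {A of CompleteNormedModule R[i] A & isCStarAlgebra R A}.

Section CStarAlgebraTheory.
Context {R : realType} {A : cstarAlgType R}.
Implicit Types (x : A) (B : set A).

Definition subalgebra B : Prop :=
  [/\ B 0,
      forall x y, B x -> B y -> B (x + y),
      forall (c : R[i]) x, B x -> B (c *: x) &
      forall x y, B x -> B y -> B (cmul x y)].

Definition cstar_subalgebra B : Prop :=
  [/\ subalgebra B, closed B & forall x, B x -> B (cstar x)].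

Definition finite_dimensional B : Prop :=
  exists (n : nat) (v : 'I_n -> A),
    B = range (fun c : 'I_n -> R[i] => \sum_(i < n) c i *: v i).

(* In the absence of a unit there is no zeroth power: iter n (cmul x) x is
   the (n+1)-st power of x. *)
Definition nilpotent_elt x : Prop := exists n : nat, iter n (cmul x) x = 0.

Definition dense_in N B : Prop := N `<=` B /\ B `<=` closure N.

End CStarAlgebraTheory.

Definition AF {R : realType} (A : cstarAlgType R) : Prop :=
  exists F : nat -> set A,
    [/\ forall n, cstar_subalgebra (F n) /\ finite_dimensional (F n),
        forall n, F n `<=` F n.+1 &
        closure (\bigcup_n F n) = [set: A]].

(* Main.v *)
From HB Require Import structures.
Require Import Defs.
From mathcomp Require Import all_boot all_order all_algebra.
From mathcomp Require Import all_solvable all_field.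
From mathcomp Require Import complex mxtens generic_quotient.
From mathcomp Require Import all_classical all_reals all_analysis.
From mathcomp Require Import ring lra zify.

(** The nil algebra is spanned by the words in generators
      z_S = t (x) Q_0^(S) (x) Q_1^(S) (x) Q_2^(S) (x) ...
    indexed by the finite sets S of natural numbers. Here t is the coordinate of
    the interval [-1, 1], each Q_l is a nilpotent matrix, and Q_l^(S) is the
    adjoint of Q_l if l belongs to S and Q_l itself otherwise.

    - If all letters of a word of length r come from sets S contained in
      {0, ..., k - 1}, its k-th factor is Q_k ^+ r. As Q_k is nilpotent, all long
      words in these letters vanish ([long_word_eq0]), and so does a high power of
      any of their linear combinations.
    - The adjoint of z_S is close to z_S', where S' is the complement of S in
      {0, ..., n - 1}: the factors below n agree, and from n on the adjoint of Q_l
      is replaced by Q_l ([ptens_flip]). So the closure of the nil algebra is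
      self-adjoint, provided that Q_l is close to its adjoint.

    Both demands on Q_l are met by [almost_diagonal_nilpotent]: for every e > 0
    there is a nilpotent matrix Q within e of a diagonal matrix Lambda with real
    entries in [-1, 1], and with a diagonal entry of modulus at least 1 - e. Up to a
    unitary change of basis it is an upper triangular Toeplitz matrix whose symbol p satisfies p(0) = 0, p(1) = 1 and
    |p| <= 1, and has a small imaginary part on the unit circle; Fourier analysis on
    a cyclic group turns this into an estimate for the matrix. Such symbols exist in
    large degree: [spread_kernel] averages over many scales at once.

    The infinite tensor products are given a meaning by an inductive limit. In level
    l there are functions on [-1, 1] with values in the tensor product of the first
    l matrix algebras, and f is identified in level l + 1 with the block-diagonal
    function t |-> f (lambda_0 t) (+) f (lambda_1 t) (+) ..., the lambda_i being the
    diagonal entries of Lambda_l. So t goes to t (x) Lambda_l, which is close to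
    t (x) Q_l, and the truncations of z_S form a sequence with summable defects
    ([gen_seq_defect]), hence converge in the limit. To have finite-dimensional
    levels, the interval is replaced by finite grids and lambda_i t is rounded; the
    limit is then AF ([tower_limit_AF]). The diagonal entries close to 1 keep the
    norms of the truncations above 1 / 2, whence z_S <> 0 for S empty
    ([gen_thread_neq0]).

    The C-star limit of such a tower consists of the sequences with one entry per
    level that are, up to small errors, eventually compatible with the connecting
    maps, modulo those that tend to 0; its norm is the limit superior of the norms. *)

Set Implicit Arguments.
Unset Strict Implicit.
Unset Printing Implicit Defensive.

Import Order.TTheory GRing.Theory Num.Theory.
Import numFieldNormedType.Exports.

Local Open Scope quotient_scope.
Local Open Scope classical_set_scope.
Local Open Scope complex_scope.
Local Open Scope ring_scope.
Local Open Scope sesquilinear_scope.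

Local Notation cabs := ComplexField.Normc.normc.

(** * The operator norm of a complex matrix *)

Section HilbertNorm.
Context {R : realType}.
Local Notation C := R[i].

Lemma normC_cabs (z : C) : `|z| = (cabs z)%:C.
Proof. by []. Qed.

Lemma cabs_ge0 (z : C) : 0 <= cabs z.
Proof. by rewrite -lecR -normC_cabs normr_ge0. Qed.

Lemma cabs_sqr (z : C) : ((cabs z) ^+ 2)%:C = z * z^*.
Proof. by rewrite rmorphXn /= -normC_cabs normCK. Qed.

Lemma cabs_conj (z : C) : cabs z^* = cabs z.
Proof. by apply: complexI; rewrite -!normC_cabs norm_conjC. Qed.

Definition hnorm n (u : 'rV[C]_n) : R := Num.sqrt (\sum_j cabs (u 0 j) ^+ 2).

Lemma hnorm_ge0 n (u : 'rV[C]_n) : 0 <= hnorm u.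
Proof. exact: sqrtr_ge0. Qed.

Lemma hnorm_sqr n (u : 'rV[C]_n) : hnorm u ^+ 2 = \sum_j cabs (u 0 j) ^+ 2.
Proof. by rewrite sqr_sqrtr// sumr_ge0// => j _; rewrite sqr_ge0. Qed.

Lemma dotmx_hnorm n (u : 'rV[C]_n) : (u *m u ^t*) 0 0 = (hnorm u ^+ 2)%:C.
Proof.
rewrite hnorm_sqr mxE rmorph_sum; apply: eq_bigr => j _ /=.
by rewrite !mxE cabs_sqr.
Qed.

Lemma hnorm_CauchySchwarz n (u v : 'rV[C]_n) : cabs ((u *m v ^t*) 0 0) <= hnorm u * hnorm v.
Proof.
have : `|dotmx u v| ^+ 2 <= dotmx u u * dotmx v v.
  exact: (CauchySchwarz (@dotmx _ n) u v).1.
rewrite !dotmxE !dotmx_hnorm normC_cabs -rmorphXn -rmorphM lecR -exprMn.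
by rewrite ler_pXn2r// ?nnegrE ?mulr_ge0 ?cabs_ge0 ?hnorm_ge0.
Qed.

Lemma cabs0 : cabs (0 : C) = 0. Proof. exact: ComplexField.Normc.normc0. Qed.

Lemma cabs1 : cabs (1 : C) = 1. Proof. exact: ComplexField.Normc.normc1. Qed.

Lemma cabsM (x y : C) : cabs (x * y) = cabs x * cabs y.
Proof. exact: ComplexField.Normc.normcM. Qed.

Lemma cabsN (x : C) : cabs (- x) = cabs x.
Proof. exact: normcN. Qed.

Lemma cabsD (x y : C) : cabs (x + y) <= cabs x + cabs y.
Proof. exact: le_normcD. Qed.

Lemma cabs_real (x : R) : cabs x%:C = `|x|.
Proof. by rewrite /ComplexField.Normc.normc /= expr0n addr0 sqrtr_sqr. Qed.

Lemma cabs_ge0_real (x : R) : 0 <= x -> cabs x%:C = x.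
Proof. by move=> x0; rewrite cabs_real ger0_norm. Qed.

(** For invertible scalars, homogeneity only has to be checked as an
    inequality: applying it to the inverse scalar gives the converse. *)
Lemma homogeneity_of_le (V : Type) (scale : C -> V -> V) (N : V -> R) :
    (forall x, 0 <= N x) -> (forall c x, N (scale c x) <= cabs c * N x) ->
    (forall c x, c != 0 -> scale c^-1 (scale c x) = x) ->
  forall c x, N (scale c x) = cabs c * N x.
Proof.
move=> N0 le scaleVK c x; apply/eqP; rewrite eq_le le /=.
have [->|c0] := eqVneq c 0; first by rewrite cabs0 mul0r N0.
have cp : 0 < cabs c.
  rewrite lt_def cabs_ge0 andbT; apply: contraNneq c0.
  by move/ComplexField.Normc.eq0_normc => ->.
rewrite -ler_pdivlMl// -{1}(scaleVK c x c0).
by rewrite (le_trans (le _ _))// ComplexField.Normc.normcV.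
Qed.

Lemma hnorm0 n : hnorm (0 : 'rV[C]_n) = 0.
Proof.
by rewrite /hnorm big1 ?sqrtr0// => j _; rewrite mxE cabs0 expr0n.
Qed.

Lemma hnorm_le n (u : 'rV[C]_n) c : 0 <= c ->
  (hnorm u <= c) = (hnorm u ^+ 2 <= c ^+ 2).
Proof. by move=> c0; rewrite ler_pXn2r// nnegrE// hnorm_ge0. Qed.

Lemma hnormZ n (u : 'rV[C]_n) c : hnorm (c *: u) = cabs c * hnorm u.
Proof.
apply/eqP; rewrite -(@eqrXn2 _ 2)// ?mulr_ge0 ?hnorm_ge0 ?cabs_ge0//.
rewrite exprMn !hnorm_sqr mulr_sumr; apply/eqP/eq_bigr => j _.
by rewrite mxE cabsM exprMn.
Qed.

(** Cancels a factor that may vanish: Cauchy-Schwarz estimates bound x ^+ 2 by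
    x * c where a bound on x is wanted. *)
Lemma ler_of_sqr_le (x c : R) : 0 <= c -> x ^+ 2 <= x * c -> x <= c.
Proof. by move=> c0; nra. Qed.

Lemma hnormD n (u v : 'rV[C]_n) : hnorm (u + v) <= hnorm u + hnorm v.
Proof.
apply: ler_of_sqr_le; first by rewrite addr_ge0 ?hnorm_ge0.
rewrite -(cabs_ge0_real (sqr_ge0 _)) -dotmx_hnorm.
have -> : (u + v) ^t* = u ^t* + v ^t* by rewrite linearD /= map_mxD.
rewrite mulmxDr mxE (le_trans (cabsD _ _))// mulrDr.
by rewrite lerD// hnorm_CauchySchwarz.
Qed.

Lemma hnorm_sum n (I : Type) (r : seq I) (P : pred I) (F : I -> 'rV[C]_n) :
  hnorm (\sum_(i <- r | P i) F i) <= \sum_(i <- r | P i) hnorm (F i).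
Proof.
apply: (big_ind2 (fun u c => hnorm u <= c)) => //; first by rewrite hnorm0.
by move=> u c v d uc vd; rewrite (le_trans (hnormD _ _))// lerD.
Qed.

Lemma le_hnorm n (u : 'rV[C]_n) j : cabs (u 0 j) <= hnorm u.
Proof.
rewrite -(@ler_pXn2r _ 2)// ?nnegrE ?cabs_ge0 ?hnorm_ge0// hnorm_sqr.
by rewrite (bigD1 j)//= lerDl sumr_ge0// => i _; rewrite sqr_ge0.
Qed.

Lemma adjmxM m n p (A : 'M[C]_(m, n)) (B : 'M[C]_(n, p)) :
  (A *m B) ^t* = B ^t* *m A ^t*.
Proof. by rewrite trmx_mul map_mxM. Qed.

Lemma adjmxD m n (A B : 'M[C]_(m, n)) : (A + B) ^t* = A ^t* + B ^t*.
Proof. by rewrite linearD /= map_mxD. Qed.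

Lemma adjmxZ m n c (A : 'M[C]_(m, n)) : (c *: A) ^t* = c^* *: A ^t*.
Proof. by rewrite linearZ /= map_mxZ. Qed.

Definition opbound m n (A : 'M[C]_(m, n)) : set R :=
  [set c | 0 <= c /\ forall u, hnorm (u *m A) <= c * hnorm u].

(** Vectors are rows and matrices act on the right, so the operator is
    u |-> u *m A. The infimum of the admissible bounds is attained, see
    [hnorm_mulmx_le]. *)
Definition opnorm m n (A : 'M[C]_(m, n)) : R := inf (opbound A).

Lemma opbound_neq0 m n (A : 'M[C]_(m, n)) : opbound A !=set0.
Proof.
exists (\sum_i hnorm (row i A)); split.
  by rewrite sumr_ge0// => i _; exact: hnorm_ge0.
move=> u; rewrite mulmx_sum_row (le_trans (hnorm_sum _ _ _))// mulr_suml.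
by apply: ler_sum => i _; rewrite hnormZ mulrC ler_wpM2l ?hnorm_ge0// le_hnorm.
Qed.

Lemma has_inf_opbound m n (A : 'M[C]_(m, n)) : has_inf (opbound A).
Proof. by split; [exact: opbound_neq0 | exists 0 => c []]. Qed.

Lemma opnorm_ge0 m n (A : 'M[C]_(m, n)) : 0 <= opnorm A.
Proof. by apply: lb_le_inf; [exact: opbound_neq0 | move=> c []]. Qed.

Lemma opnorm_le m n (A : 'M[C]_(m, n)) c : 0 <= c ->
  (forall u, hnorm (u *m A) <= c * hnorm u) -> opnorm A <= c.
Proof. by move=> c0 h; apply: ge_inf => //; have [] := has_inf_opbound A. Qed.

Lemma hnorm_mulmx_le m n (A : 'M[C]_(m, n)) u : hnorm (u *m A) <= opnorm A * hnorm u.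
Proof.
have [u0|u0] := eqVneq (hnorm u) 0.
  by have [c [_ /(_ u)]] := opbound_neq0 A; rewrite u0 !mulr0.
have up : 0 < hnorm u by rewrite lt_def u0 hnorm_ge0.
rewrite -ler_pdivrMr//; apply: lb_le_inf; first exact: opbound_neq0.
by move=> c [_ /(_ u)]; rewrite ler_pdivrMr.
Qed.

Lemma opnormD m n (A B : 'M[C]_(m, n)) : opnorm (A + B) <= opnorm A + opnorm B.
Proof.
apply: opnorm_le => [|u]; first by rewrite addr_ge0 ?opnorm_ge0.
by rewrite mulmxDr (le_trans (hnormD _ _))// mulrDl lerD// hnorm_mulmx_le.
Qed.

Lemma opnormZ_le m n c (A : 'M[C]_(m, n)) : opnorm (c *: A) <= cabs c * opnorm A.
Proof.
apply: opnorm_le => [|u]; first by rewrite mulr_ge0 ?opnorm_ge0 ?cabs_ge0.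
by rewrite -scalemxAr hnormZ -mulrA ler_wpM2l ?cabs_ge0// hnorm_mulmx_le.
Qed.

Lemma opnormZ m n c (A : 'M[C]_(m, n)) : opnorm (c *: A) = cabs c * opnorm A.
Proof.
apply: (homogeneity_of_le (scale := fun c (B : 'M[C]_(m, n)) => c *: B)).
- exact: opnorm_ge0.
- exact: opnormZ_le.
- by move=> d B d0; rewrite scalerA mulVf// scale1r.
Qed.

Lemma opnorm0 m n : opnorm (0 : 'M[C]_(m, n)) = 0.
Proof. by rewrite -(scale0r (0 : 'M[C]_(m, n))) opnormZ cabs0 mul0r. Qed.

Lemma opnormM m n p (A : 'M[C]_(m, n)) (B : 'M[C]_(n, p)) :
  opnorm (A *m B) <= opnorm A * opnorm B.
Proof.
apply: opnorm_le => [|u]; first by rewrite mulr_ge0 ?opnorm_ge0.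
rewrite mulmxA (le_trans (hnorm_mulmx_le _ _))// [opnorm A * _]mulrC -mulrA.
by rewrite ler_wpM2l ?opnorm_ge0// hnorm_mulmx_le.
Qed.

Lemma opnorm_adj_le m n (A : 'M[C]_(m, n)) : opnorm (A ^t*) <= opnorm A.
Proof.
apply: opnorm_le => [|u]; first exact: opnorm_ge0.
apply: ler_of_sqr_le; first by rewrite mulr_ge0 ?opnorm_ge0 ?hnorm_ge0.
rewrite -[leLHS]cabs_ge0_real ?sqr_ge0// -dotmx_hnorm adjmxM trmxCK mulmxA.
rewrite (le_trans (hnorm_CauchySchwarz _ _))// mulrCA mulrA ler_wpM2r ?hnorm_ge0//.
exact: hnorm_mulmx_le.
Qed.

Lemma opnorm_adj m n (A : 'M[C]_(m, n)) : opnorm (A ^t*) = opnorm A.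
Proof.
by apply/eqP; rewrite eq_le opnorm_adj_le -{1}[A]trmxCK opnorm_adj_le.
Qed.

(** The C-star identity, in the order dictated by the right action: the squared
    length of u *m A is the value at u of the form given by A *m A ^t*. *)
Lemma opnorm_gram m n (A : 'M[C]_(m, n)) : opnorm (A *m A ^t*) = opnorm A ^+ 2.
Proof.
apply/eqP; rewrite eq_le; apply/andP; split.
  by rewrite (le_trans (opnormM _ _))// opnorm_adj expr2.
rewrite -[leRHS]sqr_sqrtr ?opnorm_ge0// ler_pXn2r ?nnegrE ?opnorm_ge0 ?sqrtr_ge0//.
apply: opnorm_le => [|u]; first exact: sqrtr_ge0.
rewrite hnorm_le ?mulr_ge0 ?sqrtr_ge0 ?hnorm_ge0//.
rewrite exprMn (sqr_sqrtr (opnorm_ge0 (A *m A ^t*))).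
rewrite -[leLHS]cabs_ge0_real ?sqr_ge0// -dotmx_hnorm adjmxM -mulmxA.
rewrite [A *m (_ *m _)]mulmxA mulmxA (le_trans (hnorm_CauchySchwarz _ _))//.
by rewrite expr2 mulrA ler_wpM2r ?hnorm_ge0// hnorm_mulmx_le.
Qed.

Lemma opnorm_cstar m n (A : 'M[C]_(m, n)) : opnorm (A ^t* *m A) = opnorm A ^+ 2.
Proof. by rewrite -{2}[A]trmxCK opnorm_gram opnorm_adj. Qed.

Lemma le_opnorm m n (A : 'M[C]_(m, n)) i j : cabs (A i j) <= opnorm A.
Proof.
have := hnorm_mulmx_le A (delta_mx 0 i); rewrite -rowE.
suff -> : hnorm (delta_mx 0 i : 'rV[C]_m) = 1.
  rewrite mulr1; apply: le_trans.
  by have -> : A i j = row i A 0 j; [rewrite mxE | exact: le_hnorm].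
rewrite /hnorm (bigD1 i)//= mxE !eqxx cabs1 expr1n big1 ?addr0 ?sqrtr1// => k ki.
by rewrite mxE (negbTE ki) andbF cabs0 expr0n.
Qed.

Lemma opnorm_coisometry m n (A : 'M[C]_(m, n)) : A *m A ^t* = 1%:M -> opnorm A <= 1.
Proof.
move=> AA; apply: opnorm_le => // u; rewrite mul1r hnorm_le ?hnorm_ge0//.
have := dotmx_hnorm (u *m A).
rewrite adjmxM -mulmxA [A *m (_ *m _)]mulmxA AA mul1mx dotmx_hnorm.
by move=> /complexI ->.
Qed.

Lemma opnorm_diag n (d : 'rV[C]_n) c : 0 <= c ->
  (forall i, cabs (d 0 i) <= c) -> opnorm (diag_mx d) <= c.
Proof.
move=> c0 h; apply: opnorm_le => // u.
rewrite hnorm_le ?mulr_ge0 ?hnorm_ge0// exprMn !hnorm_sqr mulr_sumr.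
apply: ler_sum => j _; rewrite mul_mx_diag mxE cabsM exprMn mulrC ler_wpM2r ?sqr_ge0//.
by rewrite ler_pXn2r// ?nnegrE ?cabs_ge0.
Qed.

(** * Block-diagonal matrices and tensor products *)

(** The blocks are indexed by the second tensor factor: A 0 (+) A 1 (+) ... acts
    on the slices of a vector along that factor. *)
Definition blockdiag d m (A : 'I_m -> 'M[C]_d) : 'M[C]_(d * m) :=
  \sum_i A i *t delta_mx i i.

Definition tens_slice d m (u : 'rV[C]_(d * m)) (j : 'I_m) : 'rV[C]_d :=
  \row_i u 0 (mxtens_index (i, j)).

Lemma sum_mxtens (V : nmodType) d m (F : 'I_(d * m) -> V) :
  \sum_k F k = \sum_j \sum_i F (mxtens_index (i, j)).
Proof.
rewrite exchange_big /= pair_big /=.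
rewrite (reindex (@mxtens_index d m)) //=; last first.
  exists (@mxtens_unindex d m) => k _; [exact: mxtens_indexK|exact: mxtens_unindexK].
by apply: eq_bigr => -[].
Qed.

Lemma hnorm_slice d m (u : 'rV[C]_(d * m)) :
  hnorm u ^+ 2 = \sum_j hnorm (tens_slice u j) ^+ 2.
Proof.
rewrite hnorm_sqr sum_mxtens; apply: eq_bigr => j _.
by rewrite hnorm_sqr; apply: eq_bigr => i _; rewrite mxE.
Qed.

Lemma blockdiagE d m (A : 'I_m -> 'M[C]_d) i j k l :
  blockdiag A (mxtens_index (i, j)) (mxtens_index (k, l)) = A j i k *+ (j == l).
Proof.
rewrite summxE (bigD1 j)//= big1 ?addr0 => [|t tj].
  by rewrite tensmxE mxE eqxx /= eq_sym mulr_natr.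
by rewrite tensmxE mxE eq_sym (negbTE tj) mulr0.
Qed.

Lemma slice_blockdiag d m (A : 'I_m -> 'M[C]_d) u j :
  tens_slice (u *m blockdiag A) j = tens_slice u j *m A j.
Proof.
apply/rowP => k; rewrite !mxE sum_mxtens (bigD1 j)//= [X in _ + X]big1 ?addr0.
  by apply: eq_bigr => i _; rewrite blockdiagE eqxx mxE.
by move=> t tj; rewrite big1// => i _; rewrite blockdiagE (negbTE tj) mulr0.
Qed.

(** Pythagoras: the slices of u are mutually orthogonal, and block i moves
    slice i only. *)
Lemma opnorm_blockdiag d m (A : 'I_m -> 'M[C]_d) c : 0 <= c ->
  (forall i, opnorm (A i) <= c) -> opnorm (blockdiag A) <= c.
Proof.
move=> c0 h; apply: opnorm_le => // u.
rewrite hnorm_le ?mulr_ge0 ?hnorm_ge0// exprMn !hnorm_slice mulr_sumr.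
apply: ler_sum => j _; rewrite slice_blockdiag -exprMn.
rewrite ler_pXn2r ?nnegrE ?mulr_ge0 ?hnorm_ge0//.
by rewrite (le_trans (hnorm_mulmx_le _ _))// ler_wpM2r ?hnorm_ge0.
Qed.

Lemma adjmx_tens m n p q (A : 'M[C]_(m, n)) (B : 'M[C]_(p, q)) :
  (A *t B) ^t* = A ^t* *t B ^t*.
Proof. by rewrite trmx_tens map_mxT. Qed.

Lemma tensmxDr m n p q (A : 'M[C]_(m, n)) (B D : 'M[C]_(p, q)) :
  A *t (B + D) = A *t B + A *t D.
Proof. by apply/matrixP => i j; rewrite !mxE mulrDr. Qed.

Lemma tensmxDl m n p q (A B : 'M[C]_(m, n)) (D : 'M[C]_(p, q)) :
  (A + B) *t D = A *t D + B *t D.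
Proof. by apply/matrixP => i j; rewrite !mxE mulrDl. Qed.

Lemma tensmxZl m n p q c (A : 'M[C]_(m, n)) (D : 'M[C]_(p, q)) :
  (c *: A) *t D = c *: (A *t D).
Proof. by apply/matrixP => i j; rewrite !mxE mulrA. Qed.

Lemma tensmxZr m n p q c (A : 'M[C]_(m, n)) (D : 'M[C]_(p, q)) :
  A *t (c *: D) = c *: (A *t D).
Proof. by apply/matrixP => i j; rewrite !mxE mulrCA. Qed.

Lemma blockdiagP d m (A : 'M[C]_(d * m)) (B : 'I_m -> 'M[C]_d) :
  (forall i j k l, A (mxtens_index (i, j)) (mxtens_index (k, l)) =
     B j i k *+ (j == l)) -> A = blockdiag B.
Proof.
move=> h; apply/matrixP => x y; case: (mxtens_indexP x) => i j.
by case: (mxtens_indexP y) => k l; rewrite h blockdiagE.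
Qed.

Lemma blockdiagD d m (A B : 'I_m -> 'M[C]_d) :
  blockdiag (fun i => A i + B i) = blockdiag A + blockdiag B.
Proof. by rewrite -big_split; apply: eq_bigr => i _; rewrite tensmxDl. Qed.

Lemma blockdiagZ d m c (A : 'I_m -> 'M[C]_d) :
  blockdiag (fun i => c *: A i) = c *: blockdiag A.
Proof. by rewrite scaler_sumr; apply: eq_bigr => i _; rewrite tensmxZl. Qed.

Lemma blockdiagM d m (A B : 'I_m -> 'M[C]_d) :
  blockdiag (fun i => A i *m B i) = blockdiag A *m blockdiag B.
Proof.
rewrite /blockdiag mulmx_suml; apply: eq_bigr => i _.
rewrite mulmx_sumr (bigD1 i)//= big1 ?addr0 => [|j ji].
  by rewrite tensmx_mul mul_delta_mx.
by rewrite tensmx_mul mul_delta_mx_0 ?tensmx0// eq_sym.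
Qed.

Lemma blockdiag_adj d m (A : 'I_m -> 'M[C]_d) :
  blockdiag (fun i => (A i) ^t*) = (blockdiag A) ^t*.
Proof.
rewrite /blockdiag raddf_sum map_mx_sum.
by apply: eq_bigr => i _; rewrite adjmx_tens trmx_delta map_delta_mx.
Qed.

Lemma blockdiag_tens d m (X : 'M[C]_d) (c : 'I_m -> C) :
  blockdiag (fun i => c i *: X) = X *t diag_mx (\row_i c i).
Proof.
apply/esym/blockdiagP => i j k l; rewrite tensmxE !mxE mulrnAr mulrC.
by [].
Qed.

Lemma opnorm_tens1 d m (A : 'M[C]_d) : opnorm (A *t (1%:M : 'M[C]_m)) <= opnorm A.
Proof.
have -> : A *t (1%:M : 'M[C]_m) = blockdiag (fun _ => A).
  by apply: blockdiagP => i j k l; rewrite tensmxE mxE mulr_natr.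
by apply: opnorm_blockdiag => //; exact: opnorm_ge0.
Qed.

Lemma opnorm_1tens d m (A : 'M[C]_m) : opnorm ((1%:M : 'M[C]_d) *t A) <= opnorm A.
Proof.
apply: opnorm_le => [|u]; first exact: opnorm_ge0.
pose sl (w : 'rV[C]_(d * m)) i : 'rV[C]_m := \row_j w 0 (mxtens_index (i, j)).
have hsl w : hnorm w ^+ 2 = \sum_i hnorm (sl w i) ^+ 2.
  rewrite hnorm_sqr sum_mxtens exchange_big; apply: eq_bigr => i _ /=.
  by rewrite hnorm_sqr; apply: eq_bigr => j _; rewrite mxE.
have slA i : sl (u *m (1%:M *t A)) i = sl u i *m A.
  apply/rowP => k; rewrite !mxE sum_mxtens exchange_big (bigD1 i)//=.
  rewrite [X in _ + X]big1 ?addr0.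
    by apply: eq_bigr => j _; rewrite tensmxE !mxE eqxx mul1r.
  by move=> t ti; rewrite big1// => j _; rewrite tensmxE mxE (negbTE ti) mul0r mulr0.
rewrite hnorm_le ?mulr_ge0 ?hnorm_ge0 ?opnorm_ge0// exprMn !hsl mulr_sumr.
apply: ler_sum => i _; rewrite slA -exprMn.
by rewrite ler_pXn2r ?nnegrE ?mulr_ge0 ?hnorm_ge0 ?opnorm_ge0// hnorm_mulmx_le.
Qed.

(** A *t B is the product of A *t 1 and 1 *t B, each of which is a direct sum of
    copies of one matrix. *)
Lemma opnorm_tens d m (A : 'M[C]_d) (B : 'M[C]_m) :
  opnorm (A *t B) <= opnorm A * opnorm B.
Proof.
rewrite tensmx_decr (le_trans (opnormM _ _))// ler_pM ?opnorm_ge0//.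
  exact: opnorm_tens1.
exact: opnorm_1tens.
Qed.

End HilbertNorm.

#[global] Opaque opnorm hnorm.
(** * Nilpotent matrices close to a real diagonal matrix *)

Section Toeplitz.
Context {R : realType}.
Local Notation C := R[i].

Lemma prim_root_exists n : (0 < n)%N -> exists w : C, n.-primitive_root w.
Proof.
move=> n0; pose p : {poly C} := 'X^n - 1.
have [r rE] := closed_field_poly_normal p.
have p0 : p \is monic by rewrite monicXnsubC.
rewrite (monicP p0) scale1r in rE.
have sr : size r = n.
  by have := size_XnsubC (1 : C) n0; rewrite -/p rE size_prod_XsubC => -[].
have ru : all n.-unity_root r.
  by apply/allP => z zr; rewrite /root_of_unity -/p rE root_prod_XsubC.
have ur : uniq r.
  rewrite -separable_prod_XsubC -rE.
  by apply: separable_Xn_sub_1; rewrite pnatr_eq0 -lt0n.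
have /hasP[w _ wn] := has_prim_root n0 ru ur (eq_leq (esym sr)).
by exists w.
Qed.

(** The n characters of the cyclic group of order n are orthogonal: a geometric
    sum whose ratio is an n-th root of unity other than 1 vanishes. *)
Lemma sum_prim_root_orthogonal n (w : C) a b : n.-primitive_root w -> (a < n)%N -> (b < n)%N ->
  \sum_(r < n) w ^+ (a * r) * (w ^+ (b * r))^* = n%:R *+ (a == b).
Proof.
move=> wn an bn.
have w1 : `|w| = 1.
  apply/eqP; rewrite -(@pexpr_eq1 _ _ n) ?(prim_order_gt0 wn)//.
  by rewrite -normrX (prim_expr_order wn) normr1.
have ww : w * w^* = 1 by rewrite -normCK w1 expr1n.
pose x := w ^+ a * (w^*) ^+ b.
have xn : x ^+ n = 1.
  rewrite exprMn -!exprM mulnC [(b * n)%N]mulnC !exprM -rmorphXn.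
  by rewrite (prim_expr_order wn) rmorph1 !expr1n mulr1.
have -> : \sum_(r < n) w ^+ (a * r) * (w ^+ (b * r))^* = \sum_(r < n) x ^+ r.
  by apply: eq_bigr => r _; rewrite exprMn -!exprM rmorphXn.
have [ab|ab] := eqVneq a b.
  rewrite (eq_bigr (fun=> 1)) ?sumr_const ?card_ord// => r _.
  by rewrite /x ab -exprMn ww !expr1n.
have x1 : x - 1 != 0.
  apply: contra_neq ab => /subr0_eq x1.
  have : w ^+ a == w ^+ b.
    have := congr1 (fun y => y * w ^+ b) x1.
    by rewrite /x -mulrA -exprMn [_^* * _]mulrC ww expr1n mulr1 mul1r => ->.
  by rewrite (eq_prim_root_expr wn) !modn_small// => /eqP.
by apply: (mulfI x1); rewrite mulr0 -(@subrX1 C x n) xn subrr.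
Qed.

(** The upper triangular Toeplitz matrix with symbol p, that is p evaluated at
    the nilpotent shift. *)
Definition toeplitz m (p : {poly C}) : 'M[C]_m :=
  \matrix_(i, j) if (i <= j)%N then p`_(j - i) else 0.

(** The first m rows of the unitary discrete Fourier transform of size n. *)
Definition dft m n (w : C) : 'M[C]_(m, n) :=
  \matrix_(i, r) ((Num.sqrt n%:R)^-1%:C * w ^+ (i * r)).

Lemma sqrtn_inv n : (0 < n)%N ->
  ((Num.sqrt n%:R : R)^-1)%:C * ((Num.sqrt n%:R : R)^-1)%:C = n%:R^-1 :> C.
Proof.
by move=> n0; rewrite -rmorphM -invrM ?unitfE ?gt_eqF ?sqrtr_gt0 ?ltr0n//
  -expr2 sqr_sqrtr ?ler0n// fmorphV rmorph_nat.
Qed.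

(** For n large compared to m, a Toeplitz matrix is a corner of a circulant one,
    which the discrete Fourier transform diagonalizes; the eigenvalues are the
    values of the symbol at the n-th roots of unity. *)
Lemma dft_diag m n (w : C) (p : {poly C}) : n.-primitive_root w ->
  (m + size p <= n)%N ->
  toeplitz m p = dft m n w *m diag_mx (\row_r p.[w ^+ r]) *m (dft m n w) ^t*.
Proof.
move=> wn mn; have n0 := prim_order_gt0 wn.
apply/matrixP => i j; rewrite mxE mul_mx_diag mxE.
have -> : \sum_r (\matrix_(i, r) (dft m n w i r * (\row_r p.[w ^+ r]) 0 r)) i r *
    ((dft m n w) ^t*) r j =
  \sum_(r < n) \sum_(k < size p) n%:R^-1 * p`_k * (w ^+ ((i + k) * r) * (w ^+ (j * r))^*).
  apply: eq_bigr => r _; rewrite !mxE horner_coef mulr_sumr mulr_suml.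
  apply: eq_bigr => k _.
  rewrite rmorphM /= mulnDl exprD -exprM [(r * k)%N]mulnC.
  have -> : forall x : R, (x%:C)^* = x%:C by move=> x; rewrite conj_Creal// complex_real.
  by rewrite -(sqrtn_inv n0); ring.
rewrite exchange_big /=.
under eq_bigr => k _.
  rewrite -mulr_sumr (sum_prim_root_orthogonal wn); last 2 first.
  - by rewrite (leq_trans _ mn)// -addnS leq_add// ltnW.
  - by rewrite (leq_trans (ltn_ord j))// (leq_trans _ mn)// leq_addr.
  over.
have n0' : n%:R != 0 :> C by rewrite pnatr_eq0 -lt0n.
case: ifP => ij.
  have [kp|kp] := ltnP (j - i) (size p); last first.
    rewrite nth_default// big1// => k _.
    rewrite (_ : (i + k == j)%N = false) ?mulr0n ?mulr0//.
    by apply/eqP => e; move: kp; rewrite -e addKn leqNgt ltn_ord.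
  rewrite (bigD1 (Ordinal kp))//= subnKC// eqxx mulr1n big1 ?addr0 => [|k kn].
    by rewrite mulrAC mulVf// mul1r.
  rewrite (_ : (i + k == j)%N = false) ?mulr0n ?mulr0//.
  by apply: contraNF kn => /eqP ikj; apply/eqP/val_inj; rewrite /= -ikj addKn.
rewrite big1// => k _; rewrite (_ : (i + k == j)%N = false) ?mulr0n ?mulr0//.
by apply: contraFF ij => /eqP <-; exact: leq_addr.
Qed.

Lemma dft_coisometry m n (w : C) : n.-primitive_root w -> (m < n)%N ->
  dft m n w *m (dft m n w) ^t* = 1%:M.
Proof.
move=> wn mn; have := @dft_diag m n w 1 wn.
rewrite size_poly1 addn1 => /(_ mn).
have -> : \row_(r < n) (1 : {poly C}).[w ^+ r] = const_mx 1.
  by apply/rowP => r; rewrite !mxE hornerC.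
rewrite diag_const_mx mulmx1 => <-; apply/matrixP => i j; rewrite !mxE coef1.
by rewrite -val_eqE /=; case: ltngtP => //= [ij|->]; rewrite ?subnn// subn_eq0 leqNgt ij.
Qed.

Lemma opnorm_dft m n (w : C) : n.-primitive_root w -> (m < n)%N ->
  opnorm (dft m n w) <= 1.
Proof. by move=> wn mn; apply: opnorm_coisometry; exact: dft_coisometry. Qed.

Lemma prim_root_norm n (w : C) r : n.-primitive_root w -> cabs (w ^+ r) = 1.
Proof.
move=> wn; apply: complexI; rewrite -normC_cabs.
apply/eqP; rewrite -(@pexpr_eq1 _ _ n) ?(prim_order_gt0 wn)//.
by rewrite -normrX exprAC (prim_expr_order wn) expr1n normr1.
Qed.

Lemma opnorm_dft_diag m n (w : C) (d : 'rV[C]_n) c : n.-primitive_root w ->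
  (m < n)%N -> 0 <= c -> (forall r, cabs (d 0 r) <= c) ->
  opnorm (dft m n w *m diag_mx d *m (dft m n w) ^t*) <= c.
Proof.
move=> wn mn c0 dc.
have E1 := opnorm_dft wn mn.
apply: (le_trans (opnormM _ _)); rewrite opnorm_adj -[leRHS]mulr1.
apply: ler_pM; [exact: opnorm_ge0|exact: opnorm_ge0| |exact: E1].
apply: (le_trans (opnormM _ _)); rewrite -[leRHS]mul1r.
apply: ler_pM; [exact: opnorm_ge0|exact: opnorm_ge0|exact: E1|].
exact: opnorm_diag.
Qed.

(** A compression of a diagonal matrix is bounded by the largest entry. *)
Lemma opnorm_toeplitz m (p : {poly C}) c : 0 <= c ->
  (forall z, cabs z = 1 -> cabs p.[z] <= c) -> opnorm (toeplitz m p) <= c.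
Proof.
move=> c0 pc; have n0 : (0 < (m + size p).+1)%N by [].
have [w wn] := prim_root_exists n0.
rewrite (dft_diag wn) ?leqnSn// opnorm_dft_diag// ?ltnS ?leq_addr// => r.
by rewrite mxE pc// (prim_root_norm _ wn).
Qed.

(** The adjoint is the compression of the conjugate diagonal matrix, so that the
    skew-Hermitian part is governed by the imaginary part of the symbol. *)
Lemma opnorm_toeplitz_im m (p : {poly C}) c : 0 <= c ->
  (forall z, cabs z = 1 -> cabs (p.[z] - (p.[z])^*) <= c) ->
  opnorm (toeplitz m p - (toeplitz m p) ^t*) <= c.
Proof.
move=> c0 pc; have n0 : (0 < (m + size p).+1)%N by [].
have [w wn] := prim_root_exists n0.
rewrite (dft_diag wn) ?leqnSn//; set E := dft _ _ _; set d := \row_r _.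
have -> : E *m diag_mx d *m E ^t* - (E *m diag_mx d *m E ^t*) ^t* =
    E *m diag_mx (d - map_mx Num.conj d) *m E ^t*.
  rewrite !adjmxM trmxCK tr_diag_mx map_diag_mx mulmxA.
  by rewrite -mulmxBl -mulmxBr; congr (_ *m _ *m _); rewrite linearB.
rewrite opnorm_dft_diag// ?ltnS ?leq_addr// => r.
by rewrite !mxE pc// (prim_root_norm _ wn).
Qed.

Lemma strict_upper_nilpotent m (P : 'M[C]_m.+1) :
  (forall i j : 'I_m.+1, (j <= i)%N -> P i j = 0) -> P ^+ m.+1 = 0.
Proof.
move=> P0; suff h k : forall i j : 'I_m.+1, (j < i + k)%N -> (P ^+ k) i j = 0.
  apply/matrixP => i j; rewrite h ?mxE//.
  by rewrite (leq_trans (ltn_ord j))// leq_addl.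
elim: k => [|k IH] i j; rewrite ?addn0 => ij.
  by rewrite expr0 mxE -val_eqE gtn_eqF.
rewrite exprSr mxE big1// => l _.
have [lk|kl] := ltnP l (i + k); first by rewrite IH// mul0r.
by rewrite P0 ?mulr0//; move: ij; rewrite addnS ltnS => /leq_trans; apply.
Qed.

(** The bounds on the terms grow geometrically until 2 ^+ j * x reaches 1 and decay
    geometrically afterwards, hence a bound independent of J. The induction on J
    replaces x by 2 * x, and carries the explicit bounds 4 / x for x >= 1 and
    8 - x for x <= 1. *)
Lemma dyadic_sum_le J (a : nat -> R) (x : R) : 0 < x ->
  (forall j, a j <= 2 ^+ j * x) -> (forall j, a j * (2 ^+ j * x) <= 2) ->
  \sum_(j < J) a j <= 8.
Proof.
move=> x0 ax axx.
suff [] : (1 <= x -> (\sum_(j < J) a j) * x <= 4) /\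
    (x <= 1 -> \sum_(j < J) a j <= 8 - x).
  by case: (lerP 1 x) => [x1 /(_ isT) h _|x1 _ /(_ (ltW x1)) h]; nra.
elim: J a x x0 ax axx => [|J IH] a x x0 ax axx.
  by rewrite big_ord0; split=> x1; lra.
have x20 : 0 < 2 * x by lra.
have ax' j : a j.+1 <= 2 ^+ j * (2 * x) by rewrite mulrA -exprSr.
have axx' j : a j.+1 * (2 ^+ j * (2 * x)) <= 2.
  by rewrite [_ ^+ _ * _]mulrA -exprSr.
have [h1 h2] := IH (fun j => a j.+1) (2 * x) x20 ax' axx'.
have := ax 0%N; have := axx 0%N; rewrite expr0 mul1r => a0 a0'.
rewrite big_ord_recl /=; under eq_bigr do rewrite /bump /= add1n.
set S := \sum_(i < J) _ in h1 h2 *; split=> x1.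
  by have /h1 := (ltac:(lra) : 1 <= 2 * x); nra.
case: (lerP 1 (2 * x)) => [/[dup] x2 /h1 h|/ltW /h2 h]; last by lra.
have : S <= 4 by nra.
lra.
Qed.

(** On the unit circle, the mean of z, z ^+ 2, ..., z ^+ (2 ^ j) is close to 1
    when |z - 1| is much smaller than 2 ^- j ([powmean_near1]) and close to 0
    when it is much larger ([powmean_far]). Its imaginary part is therefore
    concentrated at the scale |z - 1| ~ 2 ^- j. *)
Definition powmean j : {poly C} := (2 ^+ j)^-1 *: \sum_(k < 2 ^ j) 'X^(k.+1).

Lemma powmeanE j (z : C) : (powmean j).[z] = (2 ^+ j)^-1 * \sum_(k < 2 ^ j) z ^+ k.+1.
Proof.
rewrite /powmean hornerZ horner_sum; congr (_ * _); apply: eq_bigr => k _.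
by rewrite hornerXn.
Qed.

Lemma pow2C j : (2 ^+ j : C) = (2 ^+ j : R)%:C.
Proof. by rewrite rmorphXn /= rmorph_nat. Qed.

Lemma cabs_pow2V j : cabs ((2 ^+ j)^-1 : C) = (2 ^+ j)^-1.
Proof. by rewrite pow2C -fmorphV cabs_ge0_real// invr_ge0 exprn_ge0. Qed.

Lemma cabsX (z : C) k : cabs (z ^+ k) = cabs z ^+ k.
Proof. by elim: k => [|k IH]; rewrite ?expr0 ?cabs1// !exprS cabsM IH. Qed.

Lemma cabs_sum (I : Type) (r : seq I) (P : pred I) (F : I -> C) :
  cabs (\sum_(i <- r | P i) F i) <= \sum_(i <- r | P i) cabs (F i).
Proof.
apply: (big_ind2 (fun u c => cabs u <= c)) => //; first by rewrite cabs0.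
by move=> u c v d uc vd; rewrite (le_trans (cabsD _ _))// lerD.
Qed.

Lemma cabs_pow_sub1 (z : C) k : cabs z = 1 -> cabs (z ^+ k - 1) <= k%:R * cabs (z - 1).
Proof.
move=> z1; rewrite subrX1 cabsM mulrC ler_wpM2r ?cabs_ge0//.
rewrite (le_trans (cabs_sum _ _ _))//.
rewrite (eq_bigr (fun=> 1)) ?sumr_const ?card_ord// => i _.
by rewrite cabsX z1 expr1n.
Qed.

Lemma powmean_near1 j (z : C) : cabs z = 1 ->
  cabs ((powmean j).[z] - 1) <= 2 ^+ j * cabs (z - 1).
Proof.
move=> z1.
have -> : (powmean j).[z] - 1 = (2 ^+ j)^-1 * \sum_(k < 2 ^ j) (z ^+ k.+1 - 1).
  rewrite powmeanE sumrB sumr_const card_ord mulrBr natrX mulVf ?expf_neq0 ?pnatr_eq0//.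
rewrite cabsM cabs_pow2V ler_pdivrMl ?exprn_gt0//.
rewrite (le_trans (cabs_sum _ _ _))//.
apply: (@le_trans _ _ (\sum_(k < 2 ^ j) 2 ^+ j * cabs (z - 1))).
  apply: ler_sum => k _; rewrite (le_trans (cabs_pow_sub1 _ z1))//.
  by rewrite ler_wpM2r ?cabs_ge0// -natrX ler_nat.
by rewrite sumr_const card_ord -[_ *+ (2 ^ j)%N]mulr_natl natrX.
Qed.

Lemma powmean_far j (z : C) : cabs z = 1 ->
  cabs (powmean j).[z] * (2 ^+ j * cabs (z - 1)) <= 2.
Proof.
move=> z1.
have e : (powmean j).[z] * (2 ^+ j * (z - 1)) = z * (z ^+ (2 ^ j) - 1).
  rewrite powmeanE subrX1 mulrACA mulrC mulrA; apply/esym.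
  under [in RHS]eq_bigr do rewrite exprS.
  rewrite -mulr_sumr.
  have n2 : (2 ^+ j : C) != 0 by rewrite expf_neq0// pnatr_eq0.
  by field.
have c2 : cabs (2 ^+ j : C) = 2 ^+ j by rewrite pow2C cabs_ge0_real// exprn_ge0.
have := congr1 (fun x => cabs x) e; rewrite !cabsM z1 mul1r c2 => ->.
rewrite (le_trans (cabsD _ _))// cabsN cabs1 cabsX z1 expr1n; lra.
Qed.

Lemma coef_powmean_ge0 j k : 0 <= (powmean j)`_k.
Proof.
rewrite /powmean coefZ coef_sum mulr_ge0 ?invr_ge0 ?exprn_ge0// sumr_ge0// => i _.
by rewrite coefXn; case: eqP.
Qed.

(** Averaging over J scales: at a given z the imaginary parts of the means sum up
    to a bounded quantity, so dividing by J makes the imaginary part as small as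
    desired, whereas the value at 1 stays 1. *)
Definition spread_kernel J : {poly C} := J%:R^-1 *: \sum_(j < J) powmean j.

Lemma spread_kernelE J (z : C) :
  (spread_kernel J).[z] = J%:R^-1 * \sum_(j < J) (powmean j).[z].
Proof. by rewrite /spread_kernel hornerZ horner_sum. Qed.

Lemma cabs_natV n : cabs (n%:R^-1 : C) = n%:R^-1.
Proof.
by rewrite -(rmorph_nat (real_complex R)) -fmorphV cabs_ge0_real// invr_ge0 ler0n.
Qed.

Lemma powmean1 j : (powmean j).[1] = 1.
Proof.
rewrite powmeanE (eq_bigr (fun=> 1)) => [|k _]; last by rewrite expr1n.
by rewrite sumr_const card_ord natrX mulVf// expf_neq0// pnatr_eq0.
Qed.

Lemma spread_kernel1 J : (0 < J)%N -> (spread_kernel J).[1] = 1.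
Proof.
move=> J0; rewrite spread_kernelE (eq_bigr (fun=> 1)) => [|k _]; last exact: powmean1.
by rewrite sumr_const card_ord mulVf// pnatr_eq0 -lt0n.
Qed.

Lemma coef_spread_kernel_ge0 J k : 0 <= (spread_kernel J)`_k.
Proof.
rewrite /spread_kernel coefZ coef_sum mulr_ge0 ?invr_ge0 ?ler0n// sumr_ge0// => i _.
exact: coef_powmean_ge0.
Qed.

Lemma coef0_spread_kernel J : (spread_kernel J)`_0 = 0.
Proof.
rewrite /spread_kernel coefZ coef_sum big1 ?mulr0// => j _.
by rewrite /powmean coefZ coef_sum big1 ?mulr0// => i _; rewrite coefXn.
Qed.

Lemma powmean_le1 j (z : C) : cabs z = 1 -> cabs (powmean j).[z] <= 1.
Proof.
move=> z1; rewrite powmeanE cabsM cabs_pow2V ler_pdivrMl ?exprn_gt0// mulr1.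
rewrite (le_trans (cabs_sum _ _ _))// (eq_bigr (fun=> 1)) => [|k _]; last first.
  by rewrite cabsX z1 expr1n.
by rewrite sumr_const card_ord natrX.
Qed.

Lemma spread_kernel_le1 J (z : C) : (0 < J)%N -> cabs z = 1 ->
  cabs (spread_kernel J).[z] <= 1.
Proof.
move=> J0 z1; rewrite spread_kernelE cabsM cabs_natV ler_pdivrMl ?ltr0n// mulr1.
rewrite (le_trans (cabs_sum _ _ _))//.
apply: (@le_trans _ _ (\sum_(j < J) 1)); last by rewrite sumr_const card_ord.
by apply: ler_sum => j _; exact: powmean_le1.
Qed.

Lemma spread_kernel_im J (z : C) : (0 < J)%N -> cabs z = 1 ->
  cabs ((spread_kernel J).[z] - ((spread_kernel J).[z])^*) <= 16 / J%:R.
Proof.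
move=> J0 z1; have [->|z1'] := eqVneq z 1.
  by rewrite spread_kernel1// rmorph1 subrr cabs0 divr_ge0.
pose a j := cabs ((powmean j).[z] - (powmean j).[z]^*) / 2.
have x0 : 0 < cabs (z - 1).
  rewrite lt_def cabs_ge0 andbT; apply: contra_neq z1'.
  by move/ComplexField.Normc.eq0_normc/subr0_eq.
have : \sum_(j < J) a j <= 8.
  apply: (@dyadic_sum_le J a _ x0) => j; rewrite /a.
    rewrite ler_pdivrMr//.
    have -> : (powmean j).[z] - ((powmean j).[z])^* =
       ((powmean j).[z] - 1) - ((powmean j).[z] - 1)^*.
      by rewrite rmorphB rmorph1 opprB addrA subrK.
    rewrite (le_trans (cabsD _ _))// cabsN cabs_conj.
    by have := powmean_near1 j z1; lra.
  have : cabs ((powmean j).[z] - (powmean j).[z]^*) <= 2 * cabs (powmean j).[z].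
    by rewrite (le_trans (cabsD _ _))// cabsN cabs_conj mulr2n mulrDl mul1r.
  have : 0 <= 2 ^+ j * cabs (z - 1) by rewrite mulr_ge0 ?exprn_ge0 ?cabs_ge0.
  by have := powmean_far j z1; nra.
rewrite /a -mulr_suml ler_pdivrMr// => h.
have -> : (spread_kernel J).[z] - ((spread_kernel J).[z])^* =
    J%:R^-1 * \sum_(j < J) ((powmean j).[z] - (powmean j).[z]^*).
  by rewrite spread_kernelE rmorphM /= fmorphV rmorph_nat rmorph_sum -mulrBr sumrB.
rewrite cabsM cabs_natV mulrC ler_wpM2r ?invr_ge0 ?ler0n//.
by rewrite (le_trans (cabs_sum _ _ _))//; move: h; lra.
Qed.

(** The unit vector with equal coordinates; on it, a large Toeplitz matrix takes
    nearly the value of its symbol at 1. *)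
Definition flat m : 'rV[C]_m := const_mx ((Num.sqrt m%:R)^-1)%:C.

Lemma hnorm_flat m : (0 < m)%N -> hnorm (flat m) = 1.
Proof.
move=> m0; apply/eqP; rewrite -(@eqrXn2 _ 2)// ?hnorm_ge0// expr1n hnorm_sqr.
rewrite (eq_bigr (fun=> m%:R^-1)) => [|i _]; last first.
  by apply: complexI; rewrite cabs_sqr mxE conj_Creal ?complex_real// (sqrtn_inv m0) fmorphV rmorph_nat.
by rewrite sumr_const card_ord -[_ *+ _]mulr_natr mulVf// pnatr_eq0 -lt0n.
Qed.

(** All rows of the Toeplitz matrix but the last [size p] sum to p.[1]. *)
Lemma flat_toeplitz m (p : {poly C}) : (0 < m)%N -> (forall k, 0 <= p`_k) ->
  p.[1] = 1 ->
  1 - (size p)%:R / m%:R <= (flat m *m toeplitz m p *m (flat m) ^t*) 0 0.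
Proof.
move=> m0 p0 p1; set u := flat m.
have m0' : (0 : C) < m%:R by rewrite ltr0n.
have uE : (u *m toeplitz m p *m u ^t*) 0 0 =
    m%:R^-1 * \sum_i \sum_j toeplitz m p i j.
  rewrite mxE exchange_big mulr_sumr; apply: eq_bigr => j _ /=.
  rewrite !mxE conj_Creal ?complex_real// mulr_suml mulr_sumr.
  by apply: eq_bigr => i _; rewrite !mxE -(sqrtn_inv m0); ring.
rewrite uE -(@ler_pM2l _ m%:R)// mulrBr mulr1 !mulrA [_ * _ / _]mulrAC divff ?gt_eqF//.
rewrite !mul1r.
have T0 i j : 0 <= toeplitz m p i j by rewrite mxE; case: ifP.
have Trow (i : 'I_m) : (i + size p <= m)%N -> \sum_j toeplitz m p i j = 1.
  move=> im; rewrite -p1.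
  have im' : (i <= m)%N by rewrite ltnW.
  pose F j : C := if (i <= j)%N then p`_(j - i) else 0.
  rewrite (eq_bigr (fun j : 'I_m => F j)) => [|j _]; last by rewrite mxE.
  rewrite -(big_mkord predT F) (@big_cat_nat _ _ _ i)//=.
  rewrite big_nat big1 ?add0r => [|j /andP[_ ji]]; last by rewrite /F leqNgt ji.
  rewrite -{1}[nat_of_ord i]add0n big_addn big_mkord.
  rewrite (@horner_coef_wide _ (m - i)%N) ?leq_subRL//.
  by apply: eq_bigr => k _; rewrite /F leq_addl addnK expr1n mulr1.
have sm : (m - size p <= m)%N by exact: leq_subr.
apply: (@le_trans _ _ ((m - size p)%N%:R)).
  have [ms|sm'] := leqP (size p) m; first by rewrite natrB.
  by rewrite (le_trans _ (ler0n _ _))// subr_le0 ler_nat ltnW.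
apply: (@le_trans _ _ (\sum_(i < m | (i < m - size p)%N) 1)).
  by rewrite (big_ord_narrow sm) /= sumr_const card_ord.
rewrite big_mkcond /=; apply: ler_sum => i _; case: ifP => im; last exact: sumr_ge0.
by rewrite Trow// -leq_subRL 1?ltnW//; move: im; move: (nat_of_ord i) (size p) => a b; lia.
Qed.

Lemma hermitian_diagonalization n (H : 'M[C]_n) : H ^t* = H ->
  exists (U : 'M[C]_n) (l : 'I_n -> R),
    [/\ U *m U ^t* = 1%:M, U ^t* *m U = 1%:M &
        U *m H *m U ^t* = diag_mx (\row_i (l i)%:C)].
Proof.
move=> hH; have /orthomx_spectralP : H \is normalmx by apply/normalmxP; rewrite hH.
set U := spectralmx H; set d := spectral_diag H => HE.
have Uu : U \is unitarymx by exact: spectral_unitarymx.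
have UU : U *m U ^t* = 1%:M by apply/unitarymxP.
have UU' : U ^t* *m U = 1%:M by apply: mulmx1C.
have HD : U *m H *m U ^t* = diag_mx d.
  by rewrite HE invmx_unitary// !mulmxA UU mul1mx -mulmxA UU mulmx1.
exists U, (fun i => complex.Re (d 0 i)); split => //; rewrite HD; congr diag_mx.
apply/rowP => i; rewrite mxE; apply/esym/RRe_real/CrealP.
have : (diag_mx d) ^t* = diag_mx d by rewrite -HD !adjmxM trmxCK hH mulmxA.
by move=> /matrixP /(_ i i); rewrite !mxE eqxx !mulr1n.
Qed.

Lemma quadratic_le_max n (l : 'I_n -> R) c (u : 'rV[C]_n) : hnorm u = 1 ->
  (forall i, l i <= c) ->
  (u *m diag_mx (\row_i (l i)%:C) *m u ^t*) 0 0 <= c%:C.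
Proof.
move=> u1 lc; have -> : c%:C = c%:C * (u *m u ^t*) 0 0 :> C.
  by rewrite dotmx_hnorm u1 expr1n mulr1.
rewrite !mxE mulr_sumr; apply: ler_sum => i _.
rewrite mul_mx_diag !mxE mulrAC mulrC ler_wpM2r//; last by rewrite lecR.
by rewrite -cabs_sqr ler0c sqr_ge0.
Qed.

Lemma flat_toeplitz_herm m (p : {poly C}) : (0 < m)%N -> (forall k, 0 <= p`_k) ->
  p.[1] = 1 ->
  (1 - (size p)%:R / m%:R)%:C <=
  (flat m *m (2^-1 *: (toeplitz m p + (toeplitz m p) ^t*)) *m (flat m) ^t*) 0 0.
Proof.
move=> m0 p0 p1; have := flat_toeplitz m0 p0 p1; set P := toeplitz m p.
set u := flat m; set w := (u *m P *m u ^t*) 0 0 => hw.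
have hw' : (1 - (size p)%:R / m%:R)%:C <= w.
  by rewrite rmorphB rmorph1 rmorphM fmorphV !rmorph_nat.
have wr : w^* = w.
  by apply/CrealP; rewrite -(ler_real hw'); rewrite complex_real.
have wa : (u *m P ^t* *m u ^t*) 0 0 = w.
  have <- : (u *m P *m u ^t*) ^t* = u *m P ^t* *m u ^t*.
    by rewrite !adjmxM trmxCK mulmxA.
  by rewrite 2!mxE -/w.
rewrite -scalemxAr -scalemxAl mulmxDr mulmxDl 2!mxE -/w wa -mulr2n -[w *+ 2]mulr_natl.
by rewrite mulrA mulVf ?mul1r// pnatr_eq0.
Qed.

(** A strictly upper triangular Toeplitz matrix P with symbol [spread_kernel J] is
    a nilpotent contraction at distance at most e / 2 from its Hermitian part H.
    Diagonalizing H by a unitary U, the conjugate of P by U is close to a real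
    diagonal matrix. The quadratic form of H is almost 1 at the flat vector, so
    some eigenvalue is almost 1, and so is the corresponding diagonal entry. *)
Theorem almost_diagonal_nilpotent (e : R) : 0 < e ->
  exists (m : nat) (Q : 'M[C]_m.+1) (l : 'I_m.+1 -> R) (i0 : 'I_m.+1),
    [/\ Q ^+ m.+1 = 0, opnorm Q <= 1,
        opnorm (Q - diag_mx (\row_i (l i)%:C)) <= e,
        forall i, `|l i| <= 1 & 1 - e <= cabs (Q i0 i0)].
Proof.
move=> e0; have e2 : e / 2 <= e by lra.
have lower (a b c : R) : 1 - e / 2 <= c -> b <= e / 2 -> c <= a + b -> 1 - e <= a.
  by move=> *; lra.
have [p [p0 p0' p1 pc pim]] : exists p : {poly C}, [/\ p`_0 = 0, forall k, 0 <= p`_k,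
    p.[1] = 1, forall z, cabs z = 1 -> cabs p.[z] <= 1 &
    forall z, cabs z = 1 -> cabs (p.[z] - (p.[z])^*) <= e].
  (* 16 / J is the bound of [spread_kernel_im] on the imaginary part. *)
  pose J := (Num.truncn (16 / e)).+1.
  have Je : 16 / J%:R <= e :> R.
    rewrite ler_pdivrMr ?ltr0n// -ler_pdivrMl// mulrC ltW//.
    exact: truncnS_gt.
  exists (spread_kernel J); split => [|k||z|z z1].
  - exact: coef0_spread_kernel.
  - exact: coef_spread_kernel_ge0.
  - exact: spread_kernel1.
  - exact: spread_kernel_le1.
  - exact: le_trans (spread_kernel_im _ z1) Je.
(* The flat vector loses at most size p / m.+1, by [flat_toeplitz]. *)
have [m me] : exists m : nat, (size p)%:R / m.+1%:R < e / 2 :> R.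
  exists (Num.truncn ((size p)%:R / (e / 2))).
  rewrite ltr_pdivrMr ?ltr0n// -ltr_pdivrMl ?divr_gt0// mulrC.
  exact: truncnS_gt.
pose P := toeplitz m.+1 p.
have Pm : P ^+ m.+1 = 0.
  apply: strict_upper_nilpotent => i j ji; rewrite mxE; case: ifP => // ij.
  have -> : (j - i = 0)%N by apply/eqP; rewrite subn_eq0.
  exact: p0.
have P1 : opnorm P <= 1 by exact: opnorm_toeplitz.
have Pim : opnorm (P - P ^t*) <= e by apply: opnorm_toeplitz_im => //; exact: ltW.
pose H : 'M[C]_m.+1 := 2^-1 *: (P + P ^t*).
have hH : H ^t* = H.
  by rewrite adjmxZ adjmxD trmxCK addrC fmorphV rmorph_nat.
have [U [l [UU UU' HD]]] := hermitian_diagonalization hH.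
have U1 : opnorm U <= 1 by exact: opnorm_coisometry.
have U1' : opnorm (U ^t*) <= 1 by rewrite opnorm_adj.
have conjU A c : opnorm A <= c -> opnorm (U *m A *m U ^t*) <= c.
  move=> Ac; rewrite (le_trans (opnormM _ _))// -[leRHS]mulr1 ler_pM ?opnorm_ge0//.
  by rewrite (le_trans (opnormM _ _))// -[leRHS]mul1r ler_pM ?opnorm_ge0.
have c2 : cabs (2^-1 : C) = 2^-1 by exact: (cabs_natV 2).
have H1 : opnorm H <= 1.
  rewrite opnormZ c2 ler_pdivrMl// mulr1 (le_trans (opnormD _ _))//.
  by rewrite opnorm_adj (le_trans (lerD P1 P1)).
have PH : opnorm (P - H) <= e / 2.
  have -> : P - H = 2^-1 *: (P - P ^t*).
    rewrite /H scalerDr scalerBr opprD addrA; congr (_ - _).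
    rewrite -{1}[P](scalerK (_ : 2 != 0 :> C)) ?pnatr_eq0// -scalerBr; congr (_ *: _).
    by rewrite scaler_nat mulr2n addrK.
  by rewrite opnormZ c2 mulrC ler_wpM2r// invr_ge0.
pose Q := U *m P *m U ^t*.
have Qk k : Q ^+ k = U *m (P ^+ k) *m U ^t*.
  elim: k => [|k IH]; first by rewrite !expr0 mulmx1 UU.
  rewrite exprSr IH exprSr -[_ * Q]/(_ *m Q) /Q !mulmxA.
  by rewrite -[_ *m U ^t* *m U]mulmxA UU' mulmx1.
have QD : opnorm (Q - diag_mx (\row_i (l i)%:C)) <= e / 2.
  by rewrite -HD /Q -mulmxBl -mulmxBr conjU.
have l1 i : `|l i| <= 1.
  have := le_opnorm (U *m H *m U ^t*) i i; rewrite {1}HD !mxE eqxx mulr1n cabs_real.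
  by move/le_trans; apply; exact: conjU.
(* Otherwise H would be at most 1 - e / 2 as a form, also at the flat vector. *)
have [i0 li0] : exists i0, 1 - e / 2 <= l i0.
  apply/not_existsP => h.
  have lt i : l i <= 1 - e / 2 by have /negP := h i; rewrite -ltNge => /ltW.
  pose u := flat m.+1.
  have u1 : hnorm (u *m U ^t*) = 1.
    have := dotmx_hnorm (u *m U ^t*).
    rewrite adjmxM trmxCK mulmxA -[u *m _ *m U]mulmxA UU' mulmx1.
    rewrite dotmx_hnorm hnorm_flat// => /complexI /eqP.
    by rewrite eqrXn2 ?hnorm_ge0// eq_sym => /eqP.
  have := quadratic_le_max u1 lt; rewrite -HD adjmxM trmxCK !mulmxA.
  rewrite -[u *m _ *m U]mulmxA UU' mulmx1 -[u *m _ *m _ *m U]mulmxA UU' mulmx1.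
  have /[swap]/(le_trans _)/[apply] := flat_toeplitz_herm (ltn0Sn m) p0' p1.
  by rewrite lecR lerD2l lerN2 leNgt me.
have Q1 : opnorm Q <= 1 := conjU _ _ P1.
have Qm : Q ^+ m.+1 = 0 by rewrite Qk Pm mulmx0 mul0mx.
have Qi0 : 1 - e <= cabs (Q i0 i0).
  have h : cabs (Q i0 i0 - (l i0)%:C) <= e / 2.
    have <- : (Q - diag_mx (\row_i (l i)%:C)) i0 i0 = Q i0 i0 - (l i0)%:C.
      by rewrite [LHS]mxE; congr (_ + _); rewrite 3!mxE eqxx mulr1n.
    exact: le_trans (le_opnorm _ _ _) QD.
  have := cabsD (Q i0 i0) ((l i0)%:C - Q i0 i0).
  rewrite addrC subrK cabs_real -opprB cabsN => /(le_trans (ler_norm _)) h'.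
  exact: lower li0 h h'.
by exists m, Q, l, i0; split; [exact: Qm|exact: Q1|exact: le_trans QD e2|exact: l1|exact: Qi0].
Qed.
End Toeplitz.

(** * Towers and their admissible threads *)

(** An inductive system of finite-dimensional star-algebras with C-star
    seminorms, whose connecting maps are contractive star-homomorphisms. *)
Record tower (R : realType) := Tower {
  lev :> nat -> lmodType R[i];
  lmul : forall l, lev l -> lev l -> lev l;
  lstar : forall l, lev l -> lev l;
  lnorm : forall l, lev l -> R;
  conn : forall l, lev l -> lev l.+1;
  lmulA : forall l (x y z : lev l), lmul x (lmul y z) = lmul (lmul x y) z;
  lmulDl : forall l (x y z : lev l), lmul (x + y) z = lmul x z + lmul y z;
  lmulDr : forall l (x y z : lev l), lmul x (y + z) = lmul x y + lmul x z;
  lmulZl : forall l c (x y : lev l), lmul (c *: x) y = c *: lmul x y;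
  lmulZr : forall l c (x y : lev l), lmul x (c *: y) = c *: lmul x y;
  lstarK : forall l (x : lev l), lstar (lstar x) = x;
  lstarD : forall l (x y : lev l), lstar (x + y) = lstar x + lstar y;
  lstarZ : forall l c (x : lev l), lstar (c *: x) = Num.conj c *: lstar x;
  lstarM : forall l (x y : lev l), lstar (lmul x y) = lmul (lstar y) (lstar x);
  lnormD : forall l (x y : lev l), lnorm (x + y) <= lnorm x + lnorm y;
  lnormZ : forall l c (x : lev l), lnorm (c *: x) = cabs c * lnorm x;
  lnormM : forall l (x y : lev l), lnorm (lmul x y) <= lnorm x * lnorm y;
  lnorm_starM : forall l (x : lev l), lnorm (lmul (lstar x) x) = lnorm x ^+ 2;
  connD : forall l (x y : lev l), conn (x + y) = conn x + conn y;
  connZ : forall l c (x : lev l), conn (c *: x) = c *: conn x;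
  connM : forall l (x y : lev l), conn (lmul x y) = lmul (conn x) (conn y);
  connS : forall l (x : lev l), conn (lstar x) = lstar (conn x);
  conn_le : forall l (x : lev l), lnorm (conn x) <= lnorm x;
  lev_fin : forall l, exists (n : nat) (v : 'I_n -> lev l),
    forall x, exists c : 'I_n -> R[i], x = \sum_(i < n) c i *: v i }.

Section Tower.
Context {R : realType} (T : tower R).
Local Notation C := R[i].
Implicit Types l n : nat.

Lemma lnorm0 l : lnorm (0 : T l) = 0.
Proof. by rewrite -(scale0r 0) lnormZ cabs0 mul0r. Qed.

Lemma lnormN l (x : T l) : lnorm (- x) = lnorm x.
Proof. by rewrite -scaleN1r lnormZ cabsN cabs1 mul1r. Qed.

Lemma lnorm_ge0 l (x : T l) : 0 <= lnorm x.
Proof. by have := lnormD x (- x); rewrite subrr lnorm0 lnormN; lra. Qed.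

Lemma lnorm_distC l (x y : T l) : lnorm (x - y) = lnorm (y - x).
Proof. by rewrite -lnormN opprB. Qed.

Lemma lnorm_tri l (y x z : T l) : lnorm (x - z) <= lnorm (x - y) + lnorm (y - z).
Proof. by rewrite -[x](subrK y) -addrA addrK lnormD. Qed.

Lemma lnorm_star l (x : T l) : lnorm (lstar x) = lnorm x.
Proof.
suff h y : lnorm y <= lnorm (lstar y :> T l).
  by apply/eqP; rewrite eq_le h -{2}[x]lstarK h.
apply: ler_of_sqr_le; first exact: lnorm_ge0.
by rewrite -lnorm_starM mulrC lnormM.
Qed.

(** The telescoping identity behind the continuity of the product. *)
Lemma lmul_sub l (x x' y y' : T l) :
  lmul x y - lmul x' y' = lmul (x - x') y + lmul x' (y - y').
Proof.
rewrite lmulDl lmulDr -[- x']scaleN1r -[- y']scaleN1r lmulZl lmulZr !scaleN1r.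
by rewrite addrA subrK.
Qed.

Lemma lstarN l (x : T l) : lstar (- x) = - lstar x.
Proof. by rewrite -[- x]scaleN1r lstarZ rmorphN rmorph1 scaleN1r. Qed.

(** Elements of the inductive limit are represented by sequences with one entry
    in each level; only the behaviour far up the tower matters. *)
Definition eventually_le (a : forall l, T l) (c : R) : Prop :=
  exists n, forall l, (n <= l)%N -> lnorm (a l) <= c.

Definition coherent n (b : forall l, T l) : Prop :=
  forall l, (n <= l)%N -> b l.+1 = conn (b l).

(** The coherent sequences represent the elements of the algebraic inductive
    limit, and the admissible ones their limits in norm. *)
Definition admissible (a : forall l, T l) : Prop := forall e, 0 < e ->
  exists n, exists2 b, coherent n b &
    forall l, (n <= l)%N -> lnorm (a l - b l) <= e.

Lemma coherent_le n b l : coherent n b -> (n <= l)%N -> lnorm (b l) <= lnorm (b n).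
Proof.
move=> bn; elim: l => [|l IH]; first by rewrite leqn0 => /eqP ->.
rewrite leq_eqVlt => /predU1P[->//|]; rewrite ltnS => nl.
by rewrite bn// (le_trans (conn_le _))// IH.
Qed.

Lemma coherentW n m b : (n <= m)%N -> coherent n b -> coherent m b.
Proof. by move=> nm bn l ml; apply: bn; exact: leq_trans ml. Qed.

Lemma admissible_bounded a : admissible a -> exists2 M, 0 <= M & eventually_le a M.
Proof.
move=> /(_ 1 ltr01)[n [b bn ab]]; exists (1 + lnorm (b n)).
  by rewrite addr_ge0 ?lnorm_ge0.
exists n => l nl; rewrite -[a l](subrK (b l)) (le_trans (lnormD _ _))//.
by rewrite lerD ?ab// coherent_le.
Qed.

Lemma coherent_admissible n b : coherent n b -> admissible b.
Proof.
by move=> bn e e0; exists n, b => // l _; rewrite subrr lnorm0 ltW.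
Qed.

Lemma coherentD n a b : coherent n a -> coherent n b -> coherent n (fun l => a l + b l).
Proof. by move=> an bn l nl; rewrite an// bn// connD. Qed.

Lemma coherentZ n c a : coherent n a -> coherent n (fun l => c *: a l).
Proof. by move=> an l nl; rewrite an// connZ. Qed.

Lemma coherentM n a b : coherent n a -> coherent n b ->
  coherent n (fun l => lmul (a l) (b l)).
Proof. by move=> an bn l nl; rewrite an// bn// connM. Qed.

Lemma coherentS n a : coherent n a -> coherent n (fun l => lstar (a l)).
Proof. by move=> an l nl; rewrite an// connS. Qed.

Lemma conn0 l : conn (0 : T l) = 0.
Proof. by rewrite -(scale0r 0) connZ scale0r. Qed.

Lemma coherent0 n : coherent n (fun l => 0).
Proof. by move=> l _; rewrite conn0. Qed.

(** This closure property is what makes the limit complete. *)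
Lemma admissible_closed a : (forall e, 0 < e -> exists2 u, admissible u &
  eventually_le (fun l => a l - u l) e) -> admissible a.
Proof.
move=> h e e0; have e20 : 0 < e / 2 by rewrite divr_gt0.
have [u uA [n au]] := h _ e20; have [m [b bm ub]] := uA _ e20.
exists (maxn n m), b; first exact: coherentW (leq_maxr _ _) bm.
move=> l; rewrite geq_max => /andP[nl ml].
by rewrite (le_trans (lnorm_tri (u l) _ _))// [e]splitr; apply: lerD; [exact: au|exact: ub].
Qed.

Lemma admissible2 (a b : forall l, T l) : admissible a -> admissible b ->
  forall e, 0 < e -> exists n a' b', [/\ coherent n a', coherent n b',
    forall l, (n <= l)%N -> lnorm (a l - a' l) <= e &
    forall l, (n <= l)%N -> lnorm (b l - b' l) <= e].
Proof.
move=> aA bA e e0; have [n [a' an aa]] := aA _ e0; have [m [b' bm bb]] := bA _ e0.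
exists (maxn n m), a', b'; split.
- exact: coherentW (leq_maxl _ _) an.
- exact: coherentW (leq_maxr _ _) bm.
- by move=> l; rewrite geq_max => /andP[nl _]; exact: aa.
- by move=> l; rewrite geq_max => /andP[_ nl]; exact: bb.
Qed.

Lemma admissibleD a b : admissible a -> admissible b ->
  admissible (fun l => a l + b l).
Proof.
move=> aA bA e e0; have [n [a' [b' [an bn aa bb]]]] := admissible2 aA bA (divr_gt0 e0 (ltr0Sn R 1)).
exists n, (fun l => a' l + b' l); first exact: coherentD.
move=> l nl; rewrite opprD addrACA (le_trans (lnormD _ _))//.
by rewrite [e]splitr lerD ?aa ?bb.
Qed.

Lemma admissibleZ c a : admissible a -> admissible (fun l => c *: a l).
Proof.
move=> aA e e0.
have c0 : 0 < cabs c + 1 by rewrite ltr_wpDl ?cabs_ge0.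
have [n [b bn ab]] := aA _ (divr_gt0 e0 c0).
exists n, (fun l => c *: b l); first exact: coherentZ.
move=> l nl; rewrite -scalerBr lnormZ.
have := ab l nl; rewrite ler_pdivlMr//; apply: le_trans.
by rewrite mulrC ler_wpM2l ?lnorm_ge0// lerDl.
Qed.

Lemma admissibleS a : admissible a -> admissible (fun l => lstar (a l)).
Proof.
move=> aA e e0; have [n [b bn ab]] := aA _ e0.
exists n, (fun l => lstar (b l)); first exact: coherentS.
by move=> l nl; rewrite -lstarN -lstarD lnorm_star ab.
Qed.

Lemma admissibleM a b : admissible a -> admissible b ->
  admissible (fun l => lmul (a l) (b l)).
Proof.
move=> aA bA e e0.
have [M M0 [n1 aM]] := admissible_bounded aA.
have [N N0 [n2 bN]] := admissible_bounded bA.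
pose d := Num.min 1 (e / (M + N + 1)).
have K0 : 0 < M + N + 1 by rewrite ltr_wpDl// addr_ge0.
have d0 : 0 < d by rewrite lt_min ltr01 divr_gt0.
have [n [a' [b' [an bn aa bb]]]] := admissible2 aA bA d0.
pose k := maxn n (maxn n1 n2); exists k, (fun l => lmul (a' l) (b' l)).
  by apply: coherentM; [exact: coherentW (leq_maxl _ _) an|exact: coherentW (leq_maxl _ _) bn].
move=> l; rewrite !geq_max => /and3P[nl n1l n2l].
rewrite lmul_sub (le_trans (lnormD _ _))//.
have de : d * (M + N + 1) <= e by rewrite -ler_pdivlMr// ge_min lexx orbT.
have d1 : d <= 1 by rewrite ge_min lexx.
have a'M : lnorm (a' l) <= M + 1.
  rewrite -[a' l](subrK (a l)) addrC (le_trans (lnormD _ _))// lerD ?aM//.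
  by rewrite lnorm_distC (le_trans (aa _ _)).
have := le_trans (lnormM (a l - a' l) (b l)) (ler_pM (lnorm_ge0 _) (lnorm_ge0 _) (aa l nl) (bN l n2l)).
have := le_trans (lnormM (a' l) (b l - b' l)) (ler_pM (lnorm_ge0 _) (lnorm_ge0 _) a'M (bb l nl)).
by clear - de; lra.
Qed.

End Tower.

(** * The limit of a tower as a normed space *)

Record adm_thread (R : realType) (T : tower R) := AdmThread {
  thread_seq :> forall l, T l;
  thread_seqP : admissible thread_seq }.

HB.instance Definition _ R T := gen_eqMixin (@adm_thread R T).
HB.instance Definition _ R T := gen_choiceMixin (@adm_thread R T).

Section Limit.
Context {R : realType} {T : tower R}.
Local Notation C := R[i].
Local Notation V := (adm_thread T).
Implicit Types (a b : V).

Lemma adm_thread_eq a b : (forall l, a l = b l) -> a = b.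
Proof.
case: a b => [a aA] [b bA] /= ab.
have {}ab : a = b by apply: functional_extensionality_dep.
by move: bA; rewrite -ab => bA; congr AdmThread; exact: Prop_irrelevance.
Qed.

Definition threadD a b := AdmThread (admissibleD (thread_seqP a) (thread_seqP b)).
Definition threadZ c a := AdmThread (admissibleZ c (thread_seqP a)).
Definition threadM a b := AdmThread (admissibleM (thread_seqP a) (thread_seqP b)).
Definition threadS a := AdmThread (admissibleS (thread_seqP a)).
Definition thread0 : V := AdmThread (coherent_admissible (@coherent0 R T 0)).

Definition tnorm_set a : set R := [set c | 0 <= c /\ eventually_le a c].
(** The limit superior of the norms of the entries. *)
Definition tnorm a : R := inf (tnorm_set a).

Lemma tnorm_set_neq0 a : tnorm_set a !=set0.
Proof. by have [M M0 aM] := admissible_bounded (thread_seqP a); exists M. Qed.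

Lemma tnorm_ge0 a : 0 <= tnorm a.
Proof. by apply: lb_le_inf; [exact: tnorm_set_neq0|move=> c []]. Qed.

Lemma tnorm_le a c : 0 <= c -> eventually_le a c -> tnorm a <= c.
Proof. by move=> c0 ac; apply: ge_inf; [exists 0 => d []|split]. Qed.

Lemma tnorm_lt a c : tnorm a < c -> eventually_le a c.
Proof.
move=> /(inf_lt (tnorm_set_neq0 a))[d [d0 [n ad]] dc].
by exists n => l nl; rewrite (le_trans (ad l nl))// ltW.
Qed.

Lemma tnorm_eventually a e : 0 < e -> eventually_le a (tnorm a + e).
Proof. by move=> e0; apply: tnorm_lt; rewrite ltrDl. Qed.

Lemma tnormD a b : tnorm (threadD a b) <= tnorm a + tnorm b.
Proof.
apply/ler_addgt0Pr => e e0; have e20 : 0 < e / 2 by rewrite divr_gt0.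
have [n an] := tnorm_eventually a e20; have [m bm] := tnorm_eventually b e20.
apply: tnorm_le; first by rewrite !addr_ge0 ?tnorm_ge0// ltW.
exists (maxn n m) => l; rewrite geq_max => /andP[nl ml].
rewrite (le_trans (lnormD _ _))// [e]splitr addrACA lerD//; [exact: an|exact: bm].
Qed.

Lemma tnormM a b : tnorm (threadM a b) <= tnorm a * tnorm b.
Proof.
(* The bound is obtained by letting e tend to 0, which [d] makes explicit. *)
have step e : 0 < e -> tnorm (threadM a b) <= (tnorm a + e) * (tnorm b + e).
  move=> e0; have [n an] := tnorm_eventually a e0; have [m bm] := tnorm_eventually b e0.
  apply: tnorm_le; first by rewrite mulr_ge0// addr_ge0 ?tnorm_ge0 ?ltW.
  exists (maxn n m) => l; rewrite geq_max => /andP[nl ml].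
  by rewrite (le_trans (lnormM _ _))// ler_pM ?lnorm_ge0//; [exact: an|exact: bm].
apply/ler_addgt0Pr => e e0.
have K0 : 0 < tnorm a + tnorm b + 1 by rewrite ltr_wpDl// addr_ge0 ?tnorm_ge0.
pose d := Num.min 1 (e / (tnorm a + tnorm b + 1)).
have d0 : 0 < d by rewrite lt_min ltr01 divr_gt0.
have d1 : d <= 1 by rewrite ge_min lexx.
have de : d * (tnorm a + tnorm b + 1) <= e by rewrite -ler_pdivlMr// ge_min lexx orbT.
have := step d d0; move: (tnorm_ge0 a) (tnorm_ge0 b) de.
by move: (tnorm (threadM _ _)) (tnorm a) (tnorm b) d0 d1 => x y z; clear; nra.
Qed.

Lemma tnormZ_le c a : tnorm (threadZ c a) <= cabs c * tnorm a.
Proof.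
apply/ler_addgt0Pr => e e0.
have c0 : 0 < cabs c + 1 by rewrite ltr_wpDl ?cabs_ge0.
have [n an] := tnorm_eventually a (divr_gt0 e0 c0).
apply: tnorm_le; first by rewrite addr_ge0 ?mulr_ge0 ?cabs_ge0 ?tnorm_ge0// ltW.
exists n => l nl; rewrite lnormZ.
rewrite (le_trans (ler_wpM2l (cabs_ge0 c) (an l nl)))// mulrDr lerD2l.
by rewrite mulrA ler_pdivrMr// mulrC ler_wpM2l ?lerDl// ltW.
Qed.

Lemma tnormZ c a : tnorm (threadZ c a) = cabs c * tnorm a.
Proof.
apply: (homogeneity_of_le (scale := threadZ)); [exact: tnorm_ge0|exact: tnormZ_le|].
by move=> d b d0; apply: adm_thread_eq => l /=; rewrite scalerA mulVf// scale1r.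
Qed.

(** The C-star identity passes to the limit superior: if the norms of the entries
    of a^* a are eventually at most c, those of a are at most sqrt c. *)
Lemma tnorm_starM a : tnorm (threadM (threadS a) a) = tnorm a ^+ 2.
Proof.
have sa : tnorm (threadS a) <= tnorm a.
  apply/ler_addgt0Pr => e e0; have [n an] := tnorm_eventually a e0.
  apply: tnorm_le; first by rewrite addr_ge0 ?tnorm_ge0// ltW.
  by exists n => l nl; rewrite lnorm_star; exact: an.
apply/eqP; rewrite eq_le; apply/andP; split.
  by rewrite (le_trans (tnormM _ _))// expr2 ler_wpM2r ?tnorm_ge0.
apply/ler_addgt0Pr => e e0; set t := tnorm (threadM _ _).
have te : 0 <= t + e by rewrite addr_ge0 ?tnorm_ge0// ltW.
have [n an] := tnorm_eventually (threadM (threadS a) a) e0.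
rewrite -[leRHS]sqr_sqrtr// ler_pXn2r ?nnegrE ?tnorm_ge0 ?sqrtr_ge0//.
apply: tnorm_le; first exact: sqrtr_ge0.
exists n => l nl; rewrite -(@ler_pXn2r _ 2)// ?nnegrE ?lnorm_ge0 ?sqrtr_ge0//.
by rewrite sqr_sqrtr// -lnorm_starM; exact: an.
Qed.

Lemma tnorm_eq0 a : (forall e, 0 < e -> eventually_le a e) -> tnorm a = 0.
Proof.
move=> a0; apply/eqP; rewrite eq_le tnorm_ge0 andbT.
by apply/ler_addgt0Pr => e e0; rewrite add0r; apply: tnorm_le; [exact: ltW|exact: a0].
Qed.

Definition threadB a b := threadD a (threadZ (-1) b).

Lemma threadBE a b l : threadB a b l = a l - b l.
Proof. by rewrite /= scaleN1r. Qed.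

Lemma tnorm_distC a b : tnorm (threadB a b) = tnorm (threadB b a).
Proof.
have -> : threadB a b = threadZ (-1) (threadB b a).
  by apply: adm_thread_eq => l /=; rewrite scalerDr scalerA mulN1r opprK scale1r addrC.
by rewrite tnormZ cabsN cabs1 mul1r.
Qed.

Lemma tnorm_tri b a c : tnorm (threadB a c) <= tnorm (threadB a b) + tnorm (threadB b c).
Proof.
have -> : threadB a c = threadD (threadB a b) (threadB b c).
  by apply: adm_thread_eq => l /=; rewrite !scaleN1r addrA subrK.
exact: tnormD.
Qed.

Definition asymp a b : bool := tnorm (threadB a b) == 0.

Lemma asymp_refl : reflexive asymp.
Proof.
move=> a; apply/eqP/tnorm_eq0 => e e0; exists 0%N => l _.
by rewrite threadBE subrr lnorm0 ltW.
Qed.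

Lemma asymp_sym : symmetric asymp.
Proof. by move=> a b; rewrite /asymp tnorm_distC. Qed.

Lemma asymp_trans : transitive asymp.
Proof.
move=> b a c /eqP ab /eqP bc; apply/eqP/le_anti; rewrite tnorm_ge0 andbT.
by rewrite (le_trans (tnorm_tri b _ _))// ab bc addr0.
Qed.

Definition asymp_equiv := EquivRel asymp asymp_refl asymp_sym asymp_trans.

End Limit.

Canonical asymp_equiv_canonical (R : realType) (T : tower R) := @asymp_equiv R T.

Definition tower_limit (R : realType) (T : tower R) : Type :=
  {eq_quot (@asymp_equiv R T)}.

HB.instance Definition _ R (T : tower R) :=
  Choice.copy (tower_limit T) {eq_quot (@asymp_equiv R T)}.

Section LimitOps.
Context {R : realType} {T : tower R}.
Local Notation C := R[i].
Local Notation V := (adm_thread T).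
Local Notation A := (tower_limit T).
Implicit Types (a b : V) (x y z : A).

Definition cls (a : V) : A := \pi_({eq_quot (@asymp_equiv R T)}) a.
Definition rep (x : A) : V := repr (x : {eq_quot (@asymp_equiv R T)}).

Lemma repK x : cls (rep x) = x.
Proof. exact: reprK. Qed.

Lemma clsP a b : cls a = cls b <-> tnorm (threadB a b) = 0.
Proof.
split=> [/eqquotP /eqP//|ab]; by apply/eqquotP/eqP.
Qed.

Lemma tnorm_rep a : tnorm (rep (cls a)) = tnorm a.
Proof.
have h : forall b c, tnorm (threadB b c) = 0 -> tnorm b <= tnorm c.
  move=> b c bc; rewrite -[leRHS]add0r -bc.
  have {1}-> : b = threadD (threadB b c) c.
    by apply: adm_thread_eq => l /=; rewrite scaleN1r subrK.
  exact: tnormD.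
have /clsP ra : cls (rep (cls a)) = cls a by exact: repK.
by apply/eqP; rewrite eq_le !h// tnorm_distC.
Qed.

Lemma cls_eq a b : (forall l, a l = b l) -> cls a = cls b.
Proof. by move=> ab; congr cls; exact: adm_thread_eq. Qed.

Lemma cls_close a b : (forall e, 0 < e -> eventually_le (fun l => a l - b l) e) ->
  cls a = cls b.
Proof.
move=> h; apply/clsP/tnorm_eq0 => e /h[n ab].
by exists n => l nl; rewrite threadBE; exact: ab.
Qed.

(** The operations are those of arbitrarily chosen representatives; the lemmas
    [limDE] to [limSE] show that the choice is immaterial. *)
Definition limD x y := cls (threadD (rep x) (rep y)).
Definition limZ c x := cls (threadZ c (rep x)).
Definition limM x y := cls (threadM (rep x) (rep y)).
Definition limS x := cls (threadS (rep x)).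
Definition lim0 : A := cls thread0.
Definition lim_norm x : C := (tnorm (rep x))%:C.

Lemma close_rep a e : 0 < e -> eventually_le (fun l => rep (cls a) l - a l) e.
Proof.
have /clsP ra : cls (rep (cls a)) = cls a by exact: repK.
by move=> e0; have [|n h] := @tnorm_lt _ _ (threadB (rep (cls a)) a) e; rewrite ?ra//;
  exists n => l nl; rewrite -threadBE; exact: h.
Qed.

Lemma limDE a b : limD (cls a) (cls b) = cls (threadD a b).
Proof.
apply/clsP/le_anti; rewrite tnorm_ge0 andbT.
have ra : tnorm (threadB (rep (cls a)) a) = 0 by apply/clsP; exact: repK.
have rb : tnorm (threadB (rep (cls b)) b) = 0 by apply/clsP; exact: repK.
have -> : threadB (threadD (rep (cls a)) (rep (cls b))) (threadD a b) =
    threadD (threadB (rep (cls a)) a) (threadB (rep (cls b)) b).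
  by apply: adm_thread_eq => l /=; rewrite !scaleN1r opprD addrACA.
by rewrite (le_trans (tnormD _ _))// ra rb addr0.
Qed.

Lemma limZE c a : limZ c (cls a) = cls (threadZ c a).
Proof.
apply/clsP.
have ra : tnorm (threadB (rep (cls a)) a) = 0 by apply/clsP; exact: repK.
have -> : threadB (threadZ c (rep (cls a))) (threadZ c a) = threadZ c (threadB (rep (cls a)) a).
  by apply: adm_thread_eq => l /=; rewrite !scaleN1r scalerBr.
by rewrite tnormZ ra mulr0.
Qed.

Lemma limME a b : limM (cls a) (cls b) = cls (threadM a b).
Proof.
apply/clsP/le_anti; rewrite tnorm_ge0 andbT.
have ra : tnorm (threadB (rep (cls a)) a) = 0 by apply/clsP; exact: repK.
have rb : tnorm (threadB (rep (cls b)) b) = 0 by apply/clsP; exact: repK.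
have -> : threadB (threadM (rep (cls a)) (rep (cls b))) (threadM a b) =
    threadD (threadM (threadB (rep (cls a)) a) (rep (cls b))) (threadM a (threadB (rep (cls b)) b)).
  by apply: adm_thread_eq => l /=; rewrite !scaleN1r lmul_sub.
rewrite (le_trans (tnormD _ _))// -[leRHS]addr0 lerD//.
  by rewrite (le_trans (tnormM _ _))// ra mul0r.
by rewrite (le_trans (tnormM _ _))// rb mulr0.
Qed.

Lemma limSE a : limS (cls a) = cls (threadS a).
Proof.
apply: cls_close => e /(close_rep a)[n h]; exists n => l nl /=.
by rewrite -lstarN -lstarD lnorm_star; exact: h.
Qed.

Let lim_ind (P : A -> Prop) : (forall a, P (cls a)) -> forall x, P x.
Proof. by move=> h x; rewrite -(repK x). Qed.

Lemma limDA : associative limD.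
Proof.
elim/lim_ind => a; elim/lim_ind => b; elim/lim_ind => c.
by rewrite !limDE; apply: cls_eq => l /=; rewrite addrA.
Qed.

Lemma limDC : commutative limD.
Proof.
elim/lim_ind => a; elim/lim_ind => b.
by rewrite !limDE; apply: cls_eq => l /=; rewrite addrC.
Qed.

Lemma lim0D : left_id lim0 limD.
Proof.
elim/lim_ind => a; by rewrite !limDE; apply: cls_eq => l /=; rewrite add0r.
Qed.

Lemma limND : left_inverse lim0 (limZ (-1)) limD.
Proof.
elim/lim_ind => a; rewrite limZE limDE; apply: cls_eq => l /=.
by rewrite scaleN1r addNr.
Qed.

HB.instance Definition _ := GRing.isZmodule.Build A limDA limDC lim0D limND.

Lemma limZA c d x : limZ c (limZ d x) = limZ (c * d) x.
Proof.
elim/lim_ind: x => a; rewrite !limZE; apply: cls_eq => l /=; exact: scalerA.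
Qed.

Lemma lim1Z : left_id 1 limZ.
Proof. by elim/lim_ind => a; rewrite limZE; apply: cls_eq => l /=; exact: scale1r. Qed.

Lemma limZDr : right_distributive limZ +%R.
Proof.
move=> c; elim/lim_ind => a; elim/lim_ind => b; rewrite -[cls a + cls b]/(limD _ _).
rewrite limDE !limZE -[RHS]/(limD _ _) limDE; apply: cls_eq => l /=; exact: scalerDr.
Qed.

Lemma limZDl x : {morph limZ^~ x : c d / c + d}.
Proof.
elim/lim_ind: x => a c d; rewrite !limZE -[RHS]/(limD _ _) limDE.
by apply: cls_eq => l /=; exact: scalerDl.
Qed.

HB.instance Definition _ := GRing.Zmodule_isLmodule.Build C A limZA lim1Z limZDr limZDl.

Lemma clsD a b : cls (threadD a b) = cls a + cls b. Proof. exact/esym/limDE. Qed.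

Lemma clsZ c a : cls (threadZ c a) = c *: cls a. Proof. exact/esym/limZE. Qed.

Lemma cls0 : cls thread0 = 0. Proof. by []. Qed.

Lemma lim_normE a : lim_norm (cls a) = (tnorm a)%:C.
Proof. by rewrite /lim_norm tnorm_rep. Qed.

Lemma lim_normD x y : lim_norm (x + y) <= lim_norm x + lim_norm y.
Proof.
elim/lim_ind: x => a; elim/lim_ind: y => b.
by rewrite -clsD !lim_normE -rmorphD lecR tnormD.
Qed.

Lemma lim_normZ c x : lim_norm (c *: x) = `|c| * lim_norm x.
Proof. by elim/lim_ind: x => a; rewrite -clsZ !lim_normE tnormZ normC_cabs -rmorphM. Qed.

Lemma lim_norm0_eq0 x : lim_norm x = 0 -> x = 0.
Proof.
elim/lim_ind: x => a; rewrite lim_normE => /complexI a0; rewrite -cls0; apply/clsP.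
have -> : threadB a thread0 = a by apply: adm_thread_eq => l /=; rewrite scaler0 addr0.
exact: a0.
Qed.

HB.instance Definition _ := Lmodule_isNormed.Build C A lim_normD lim_normZ lim_norm0_eq0.

Lemma cls_norm a : `|cls a| = (tnorm a)%:C. Proof. exact: lim_normE. Qed.
End LimitOps.

(** * Completeness of the limit *)

Section Complete.
Context {R : realType} {T : tower R}.
Local Notation C := R[i].
Local Notation V := (adm_thread T).
Local Notation A := (tower_limit T).

Let d n : R := n.+1%:R^-1.

Lemma invn_le (e : R) : 0 < e -> exists n, n.+1%:R^-1 <= e.
Proof.
move=> e0; exists (Num.truncn e^-1).
by rewrite -[leRHS]invrK lef_pV2 ?posrE ?ltr0n ?invr_gt0// ltW// truncnS_gt.
Qed.

(** A diagonal argument. Entry l of the limit is taken from the thread u (N l),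
    where N l is the largest index n <= l such that, from level l on, u n is close
    to all u m with m <= n; then N l tends to infinity with l. *)
Lemma adm_thread_complete (u : nat -> V) :
  (forall n m, tnorm (threadB (u n) (u m)) < d n + d m) ->
  exists a, forall m, tnorm (threadB a (u m)) <= 2 * d m.
Proof.
move=> uC.
have /choice[k0 k0P] : forall nm : nat * nat, exists k, forall l, (k <= l)%N ->
    lnorm (u nm.1 l - u nm.2 l) <= d nm.1 + d nm.2.
  move=> [n m] /=.
  by have [k h] := tnorm_lt (uC n m); exists k => l kl; rewrite -threadBE; exact: h.
pose k n := \max_(m < n.+1) k0 (n, nat_of_ord m).
have kP n m l : (m <= n)%N -> (k n <= l)%N -> lnorm (u n l - u m l) <= d n + d m.
  move=> mn kl; apply: (k0P (n, m)); apply: leq_trans kl.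
  by rewrite /k (leq_bigmax_cond (F := fun j : 'I_n.+1 => k0 (n, nat_of_ord j)) (Ordinal (mn : (m < n.+1)%N))).
pose N l := \max_(n < l.+1 | (k n <= l)%N) (n : nat).
have NP m l : (m <= l)%N -> (k m <= l)%N -> (m <= N l)%N /\ (k (N l) <= l)%N.
  move=> ml kl; pose m' : 'I_l.+1 := Ordinal (ml : (m < l.+1)%N).
  split; first exact: (leq_bigmax_cond (F := @nat_of_ord l.+1) m').
  have [|j jk Nj] := @eq_bigmax_cond _ (fun n : 'I_l.+1 => k n <= l)%N (@nat_of_ord l.+1).
    by apply/card_gt0P; exists m'.
  by rewrite /N Nj.
have close m : eventually_le (fun l => u (N l) l - u m l) (2 * d m).
  exists (maxn m (k m)) => l; rewrite geq_max => /andP[ml kl].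
  have [mN kN] := NP m l ml kl.
  rewrite (le_trans (kP _ _ _ mN kN))// mulr2n mulrDl mul1r lerD2r.
  by rewrite lef_pV2 ?posrE ?ltr0n// ler_nat.
have aA : admissible (fun l => u (N l) l).
  apply: admissible_closed => e e0.
  have [m dm] := invn_le (divr_gt0 e0 (ltr0Sn R 1)).
  exists (u m); first exact: thread_seqP.
  have [n h] := close m; exists n => l nl; rewrite (le_trans (h l nl))//.
  by rewrite mulrC -ler_pdivlMr.
exists (AdmThread aA) => m; apply: tnorm_le.
  by rewrite mulr_ge0// invr_ge0.
by have [n h] := close m; exists n => l nl; rewrite threadBE; exact: h.
Qed.

Lemma cls_dist (a b : V) : `|cls a - cls b| = (tnorm (threadB a b))%:C :> C.
Proof. by rewrite /threadB -cls_norm clsD clsZ scaleN1r. Qed.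

Lemma tower_limit_complete (F : set_system A) : ProperFilter F -> cauchy F -> cvg F.
Proof.
move=> FF /cauchyP Fc.
have d0 n : 0 < d n by rewrite invr_gt0.
have /choice[x xP] : forall n, exists x, F (ball x (d n)%:C).
  by move=> n; apply: Fc; rewrite ltcR.
have uC n m : tnorm (threadB (rep (x n)) (rep (x m))) < d n + d m.
  have [z []] := @filter_ex _ F FF _ (filterI (xP n) (xP m)).
  rewrite -!ball_normE /= => zn zm; rewrite -ltcR -cls_dist !repK rmorphD.
  by rewrite (le_lt_trans (ler_distD z _ _))// ltrD// distrC.
have [a aP] := adm_thread_complete uC.
apply/cvg_ex; exists (cls a); apply/fcvg_ballP => e e0.
have [r er] : exists r : R, e = r%:C by apply/complex_realP; rewrite gtr0_real.
have r0 : 0 < r by move: e0; rewrite er ltcR.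
have [m dm] := invn_le (divr_gt0 r0 (ltr0Sn R 3)).
apply: filterS (xP m) => z; rewrite -!ball_normE /= => zm.
rewrite (le_lt_trans (ler_distD (x m) _ _))// -[in `|cls a - _|](repK (x m)) cls_dist er.
apply: (@lt_le_trans _ _ ((tnorm (threadB a (rep (x m))))%:C + (d m)%:C)).
  by rewrite ltrD2l.
rewrite -rmorphD lecR; have := aP m; rewrite ler_pdivlMr// in dm.
by move: (d0 m); rewrite -/(d m) in dm *; lra.
Qed.

HB.instance Definition _ := Uniform_isComplete.Build A tower_limit_complete.

End Complete.

(** * The limit of a tower as a C-star algebra *)

Section CStar.
Context {R : realType} {T : tower R}.
Local Notation A := (tower_limit T).
Local Notation C := R[i].

Lemma limMA (x y z : A) : limM x (limM y z) = limM (limM x y) z.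
Proof.
rewrite -(repK x) -(repK y) -(repK z) !limME.
by apply: cls_eq => l /=; rewrite lmulA.
Qed.

Lemma limMDl (x y z : A) : limM (x + y) z = limM x z + limM y z.
Proof.
rewrite -(repK x) -(repK y) -(repK z) -clsD !limME -clsD.
by apply: cls_eq => l /=; rewrite lmulDl.
Qed.

Lemma limMDr (x y z : A) : limM x (y + z) = limM x y + limM x z.
Proof.
rewrite -(repK x) -(repK y) -(repK z) -clsD !limME -clsD.
by apply: cls_eq => l /=; rewrite lmulDr.
Qed.

Lemma limMZl (c : C) (x y : A) : limM (c *: x) y = c *: limM x y.
Proof.
rewrite -(repK x) -(repK y) -clsZ !limME -clsZ.
by apply: cls_eq => l /=; rewrite lmulZl.
Qed.

Lemma limMZr (c : C) (x y : A) : limM x (c *: y) = c *: limM x y.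
Proof.
rewrite -(repK x) -(repK y) -clsZ !limME -clsZ.
by apply: cls_eq => l /=; rewrite lmulZr.
Qed.

Lemma lim_normM (x y : A) : `|limM x y| <= `|x| * `|y|.
Proof.
by rewrite -(repK x) -(repK y) limME !cls_norm -rmorphM lecR tnormM.
Qed.

Lemma limSK (x : A) : limS (limS x) = x.
Proof.
by rewrite -(repK x) !limSE; apply: cls_eq => l /=; rewrite lstarK.
Qed.

Lemma limSD (x y : A) : limS (x + y) = limS x + limS y.
Proof.
rewrite -(repK x) -(repK y) -clsD !limSE -clsD.
by apply: cls_eq => l /=; rewrite lstarD.
Qed.

Lemma limSZ (c : C) (x : A) : limS (c *: x) = Num.conj c *: limS x.
Proof.
rewrite -(repK x) -clsZ !limSE -clsZ.
by apply: cls_eq => l /=; rewrite lstarZ.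
Qed.

Lemma limSM (x y : A) : limS (limM x y) = limM (limS y) (limS x).
Proof.
rewrite -(repK x) -(repK y); set a := rep x; set b := rep y.
rewrite (limME a b) (limSE (threadM a b)) (limSE a) (limSE b) (limME (threadS b)).
by apply: cls_eq => l /=; rewrite lstarM.
Qed.

Lemma lim_norm_starM (x : A) : `|limM (limS x) x| = `|x| ^+ 2.
Proof.
by rewrite -(repK x) limSE limME !cls_norm tnorm_starM rmorphXn.
Qed.

HB.instance Definition _ := isCStarAlgebra.Build R A limMA limMDl limMDr
  limMZl limMZr lim_normM limSK limSD limSZ limSM lim_norm_starM.

Lemma clsM (a b : adm_thread T) : cls (threadM a b) = cmul (cls a) (cls b).
Proof. exact/esym/limME. Qed.

Lemma clsS (a : adm_thread T) : cls (threadS a) = cstar (cls a).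
Proof. exact/esym/limSE. Qed.

End CStar.

(** * Finite-dimensional subspaces are closed *)

Section FiniteDim.
Context {R : realType} {A : normedModType R[i]}.
Local Notation C := R[i].

(** The norm takes its values in R[i], where the order is not total; all estimates
    are carried out on its real part. *)
Definition rnorm (x : A) : R := complex.Re `|x|.

Lemma rnormE (x : A) : `|x| = (rnorm x)%:C.
Proof. by rewrite /rnorm RRe_real// ger0_real. Qed.

Lemma rnorm_ge0 x : 0 <= rnorm x.
Proof. by rewrite -lecR -rnormE normr_ge0. Qed.

Lemma rnormD x y : rnorm (x + y) <= rnorm x + rnorm y.
Proof. by have := ler_normD x y; rewrite !rnormE -rmorphD lecR. Qed.

Lemma rnormZ c x : rnorm (c *: x) = cabs c * rnorm x.
Proof. by apply: complexI; have := normrZ c x; rewrite !rnormE normC_cabs -rmorphM. Qed.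

Lemma rnorm_distC x y : rnorm (x - y) = rnorm (y - x).
Proof. by apply: complexI; rewrite -!rnormE distrC. Qed.

Lemma closureNP (B : set A) x :
  closure B x <-> forall e : R, 0 < e -> exists2 b, B b & rnorm (x - b) < e.
Proof.
split=> [cB e e0|h].
  have [b [Bb]] : B `&` ball x e%:C !=set0.
    by apply: cB; apply: nbhsx_ballx; rewrite ltcR.
  by rewrite -ball_normE /= rnormE ltcR => xb; exists b.
move=> U /nbhs_ballP[e /= e0 eU].
have [r er] : exists r : R, e = r%:C by apply/complex_realP; rewrite gtr0_real.
have [b Bb xb] : exists2 b, B b & rnorm (x - b) < r.
  by apply: h; move: e0; rewrite er ltcR.
by exists b; split => //; apply: eU; rewrite -ball_normE /= rnormE er ltcR.
Qed.

(** Completeness of the reals in quantitative form: the supremum of the lower ends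
    x n - d n of the intervals lies in each of the intervals. *)
Lemma nested_limit (x d : nat -> R) : (forall n m, `|x n - x m| <= d n + d m) ->
  exists L, forall n, `|x n - L| <= d n.
Proof.
move=> h; pose S := [set y | exists n, y = x n - d n].
have Sub n : ubound S (x n + d n).
  move=> _ [m ->]; have := h m n; rewrite ler_norml => /andP[_]; lra.
have S0 : S !=set0 by exists (x 0%N - d 0%N), 0%N.
exists (sup S) => n.
have : x n - d n <= sup S.
  by apply: ub_le_sup; [exists (x 0%N + d 0%N); exact: Sub|exists n].
have : sup S <= x n + d n by apply: ge_sup.
by rewrite ler_norml; lra.
Qed.

Lemma complex_nested_limit (x : nat -> C) (d : nat -> R) :
  (forall n m, cabs (x n - x m) <= d n + d m) ->
  exists L, forall n, cabs (x n - L) <= 2 * d n.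
Proof.
move=> h.
have Re_le (z : C) : `|complex.Re z| <= cabs z.
  case: z => a b /=; rewrite -[leLHS]sqrtr_sqr ler_wsqrtr// lerDl sqr_ge0//.
have Im_le (z : C) : `|complex.Im z| <= cabs z.
  case: z => a b /=; rewrite -[leLHS]sqrtr_sqr ler_wsqrtr// lerDr sqr_ge0//.
have [a ha] : exists a, forall n, `|complex.Re (x n) - a| <= d n.
  apply: nested_limit => n m; apply: le_trans (h n m).
  by rewrite (le_trans _ (Re_le _))// raddfB.
have [b hb] : exists b, forall n, `|complex.Im (x n) - b| <= d n.
  apply: nested_limit => n m; apply: le_trans (h n m).
  by rewrite (le_trans _ (Im_le _))// raddfB.
exists (a +i* b) => n.
have -> : x n - (a +i* b) = (complex.Re (x n) - a)%:C + 'i * (complex.Im (x n) - b)%:C.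
  by case: (x n) => u v; apply/eqP; rewrite eq_complex /=; apply/andP; split; apply/eqP; ring.
rewrite (le_trans (cabsD _ _))// cabsM !cabs_real.
have -> : cabs ('i : C) = 1 by rewrite /= expr0n expr1n add0r sqrtr1.
by have := ha n; have := hb n; lra.
Qed.

(** If v is not in B, it has a positive distance e to B, so that |c| * e is a
    lower bound for the norm of b + c *: v. Hence if b_n + c_n *: v converges,
    the coefficients c_n are Cauchy, and then b_n converges in B. *)
Lemma closed_add_line (B : set A) (v : A) : closed B ->
  (forall x y, B x -> B y -> B (x + y)) -> (forall (c : C) x, B x -> B (c *: x)) ->
  closed [set x | exists b, exists2 c : C, B b & x = b + c *: v].
Proof.
move=> Bc BD BZ; have [Bv|nBv] := pselect (B v).
  suff -> : [set x | exists b, exists2 c : C, B b & x = b + c *: v] = B by [].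
  apply/seteqP; split=> x /=; first by move=> [b [c Bb ->]]; apply: BD => //; exact: BZ.
  by move=> Bx; exists x, 0; rewrite ?scale0r ?addr0.
have [e e0 he] : exists2 e : R, 0 < e & forall b, B b -> e <= rnorm (v - b).
  have /closureNP/existsNP[e /not_implyP[e0 he]] : ~ closure B v by move=> /Bc.
  by exists e => // b Bb; rewrite leNgt; apply/negP => vb; apply: he; exists b.
(* b + c *: v is c times the difference of v and a point of B. *)
have line b c : B b -> cabs c * e <= rnorm (b + c *: v).
  move=> Bb; have [->|c0] := eqVneq c 0; first by rewrite cabs0 mul0r rnorm_ge0.
  have -> : b + c *: v = c *: (v - (- c^-1) *: b).
    by rewrite scalerBr scalerA mulrN mulfV// scaleN1r opprK addrC.
  by rewrite rnormZ ler_wpM2l ?cabs_ge0//; apply: he; exact: BZ.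
pose d n : R := n.+1%:R^-1.
have d0 n : 0 < d n by rewrite invr_gt0.
move=> x /closureNP xS.
have /choice[bc bcP] : forall n, exists bc : A * C,
    B bc.1 /\ rnorm (x - (bc.1 + bc.2 *: v)) < d n.
  by move=> n; have [_ [b [c Bb ->]] xb] := xS _ (d0 n); exists (b, c).
have [c hc] : exists c, forall n, cabs ((bc n).2 - c) <= 2 * (d n / e).
  apply: complex_nested_limit => n m; rewrite -mulrDl ler_pdivlMr//.
  have /line : B ((bc n).1 + (-1) *: (bc m).1).
    by apply: BD; [|apply: BZ]; exact: (bcP _).1.
  move=> /(_ ((bc n).2 - (bc m).2)) /le_trans; apply.
  have -> : (bc n).1 + (-1) *: (bc m).1 + ((bc n).2 - (bc m).2) *: v =
     ((bc n).1 + (bc n).2 *: v - x) + (x - ((bc m).1 + (bc m).2 *: v)).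
    by rewrite addrA subrK scaleN1r scalerBl opprD addrACA.
  rewrite (le_trans (rnormD _ _))// lerD// ltW//; last exact: (bcP m).2.
  by rewrite rnorm_distC; exact: (bcP n).2.
exists (x - c *: v), c; last by rewrite subrK.
apply: Bc; apply/closureNP => r r0.
have K0 : 0 < 2 + 2 / e * rnorm v.
  by rewrite ltr_wpDr// mulr_ge0 ?rnorm_ge0// divr_ge0// ltW.
have [n dn] := invn_le (divr_gt0 r0 K0).
exists (bc n).1; first exact: (bcP n).1.
have -> : x - c *: v - (bc n).1 =
    (x - ((bc n).1 + (bc n).2 *: v)) + ((bc n).2 - c) *: v.
  by rewrite scalerBl opprD addrA addrA subrK addrAC.
rewrite (le_lt_trans (rnormD _ _))// rnormZ.
have h1 := (bcP n).2.
have h2 := ler_wpM2r (rnorm_ge0 v) (hc n).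
rewrite ler_pdivlMr// in dn; rewrite -/(d n) in dn.
apply: (lt_le_trans _ dn).
have -> : d n * (2 + 2 / e * rnorm v) = d n + d n + 2 * (d n / e) * rnorm v by ring.
by have := d0 n; lra.
Qed.

Lemma closed_span n (v : 'I_n -> A) :
  closed (range (fun c : 'I_n -> C => \sum_(i < n) c i *: v i)).
Proof.
elim: n v => [|n IH] v.
  move=> x /closureNP h.
  exists (fun=> 0) => //; rewrite big_ord0; apply/esym/eqP; rewrite -normr_eq0 rnormE.
  suff -> : rnorm x = 0 by [].
  apply/eqP; rewrite eq_le rnorm_ge0 andbT; apply/ler_addgt0Pr => e /h[_ [c _ <-]].
  by rewrite big_ord0 subr0 add0r => /ltW.
pose B : set A := range (fun c : 'I_n -> C => \sum_i c i *: v (widen_ord (leqnSn n) i)).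
suff -> : range (fun c : 'I_n.+1 -> C => \sum_i c i *: v i) =
    [set x | exists b, exists2 c : C, B b & x = b + c *: v ord_max].
  apply: closed_add_line; first exact: IH.
    move=> _ _ [c _ <-] [c' _ <-]; exists (fun i => c i + c' i) => //.
    by rewrite -big_split; apply: eq_bigr => i _; rewrite scalerDl.
  move=> k _ [c _ <-]; exists (fun i => k * c i) => //.
  by rewrite scaler_sumr; apply: eq_bigr => i _; rewrite scalerA.
apply/seteqP; split=> x /=.
  move=> [c _ <-]; rewrite big_ord_recr /=; eexists; exists (c ord_max); last by [].
  by exists (fun i => c (widen_ord (leqnSn n) i)).
move=> [_ [k [c _ <-] ->]].
exists (fun i => oapp c k (insub (nat_of_ord i))) => //.
rewrite big_ord_recr /=; congr (_ + _ *: _).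
  by apply: eq_bigr => i _; rewrite valK.
by rewrite insubF ?ltnn.
Qed.

End FiniteDim.
(** * The limit of a tower is AF *)

Section AFLimit.
Context {R : realType} (T : tower R).
Local Notation A := (tower_limit T).
Local Notation C := R[i].

(** The image of level n in the limit. *)
Definition stage n : set A := [set x | exists2 a : adm_thread T, coherent n a & x = cls a].

(** [seed f] puts f in position n, and [extend f] prolongs it by the connecting
    maps; the equality test transports f to the type of level l when n = l. *)
Definition seed n (f : T n) l : T l :=
  if n =P l is ReflectT e then ecast m (T m) e f else 0.

Fixpoint extend n (f : T n) l : T l :=
  match l with
  | 0 => seed f 0
  | l'.+1 => if (n <= l')%N then conn (extend f l') else seed f l'.+1
  end.

Lemma seed_id n (f : T n) : seed f n = f.
Proof. by rewrite /seed; case: eqP => // e; rewrite (eq_axiomK e). Qed.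

Lemma extend_id n (f : T n) : extend f n = f.
Proof. by case: n f => [|n] f; rewrite /= ?ltnn seed_id. Qed.

Lemma extend_coherent n (f : T n) : coherent n (extend f).
Proof. by move=> l nl /=; rewrite nl. Qed.

Definition thread_extend n (f : T n) : adm_thread T :=
  AdmThread (coherent_admissible (@extend_coherent n f)).

Lemma coherent_eq n (a b : forall l, T l) : coherent n a -> coherent n b ->
  a n = b n -> forall l, (n <= l)%N -> a l = b l.
Proof.
move=> an bn ab; elim=> [|l IH]; first by rewrite leqn0 => /eqP n0; move: ab; rewrite n0.
rewrite leq_eqVlt => /predU1P[nl|]; first by move: ab; rewrite nl.
by rewrite ltnS => nl; rewrite an// bn// IH.
Qed.

Lemma cls_eventually_eq n (a b : adm_thread T) :
  (forall l, (n <= l)%N -> a l = b l) -> cls a = cls b.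
Proof.
move=> ab; apply: cls_close => e e0; exists n => l nl.
by rewrite ab// subrr lnorm0 ltW.
Qed.

(** A thread that is coherent from n on is determined, up to finitely many
    entries, by its entry at n. *)
Lemma stage_finite_dimensional n : finite_dimensional (stage n).
Proof.
have [k [v vP]] := lev_fin T n.
exists k, (fun i => cls (thread_extend (v i))).
have sumE (c : 'I_k -> C) : exists2 b : adm_thread T, coherent n b /\ b n = \sum_i c i *: v i &
    \sum_i c i *: cls (thread_extend (v i)) = cls b.
  apply: (big_ind2 (fun x y => exists2 b : adm_thread T, coherent n b /\ b n = x & y = cls b)).
  - by exists thread0 => //; split => //; exact: coherent0.
  - move=> x _ y _ [a [ac <-] ->] [b [bc <-] ->].
    by exists (threadD a b); [split=> //; exact: coherentD|rewrite clsD].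
  - move=> i _; exists (threadZ (c i) (thread_extend (v i))); last by rewrite clsZ.
    by split; [apply: coherentZ; exact: extend_coherent|rewrite /= extend_id].
apply/seteqP; split=> x /=.
  move=> [a ac ->]; have [c ca] := vP (a n); exists c => //.
  have [b [bc bn] ->] := sumE c.
  by apply: (@cls_eventually_eq n); apply: coherent_eq => //; rewrite bn.
by move=> [c _ <-]; have [b [bc bn] ->] := sumE c; exists b.
Qed.

Lemma stage_cstar_subalgebra n : cstar_subalgebra (stage n).
Proof.
split; last first.
- by move=> _ [a ac ->]; rewrite -clsS; exists (threadS a) => //; exact: coherentS.
- by have [k [v ->]] := stage_finite_dimensional n; exact: closed_span.
split.
- by exists thread0 => //; exact: coherent0.
- move=> _ _ [a ac ->] [b bc ->]; rewrite -clsD.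
  by exists (threadD a b) => //; exact: coherentD.
- by move=> c _ [a ac ->]; rewrite -clsZ; exists (threadZ c a) => //; exact: coherentZ.
- move=> _ _ [a ac ->] [b bc ->]; rewrite -clsM.
  by exists (threadM a b) => //; exact: coherentM.
Qed.

Lemma rnorm_clsB (a b : adm_thread T) : rnorm (cls a - cls b) = tnorm (threadB a b).
Proof. by apply: complexI; rewrite -rnormE cls_dist. Qed.

(** Admissibility says exactly that the union of the stages is dense. *)
Theorem tower_limit_AF : AF A.
Proof.
exists stage; split.
- by move=> n; split; [exact: stage_cstar_subalgebra|exact: stage_finite_dimensional].
- by move=> n x [a ac ->]; exists a => //; exact: coherentW ac.
apply/seteqP; split=> // x _; rewrite -(repK x); set a := rep x.
apply/closureNP => e e0; have [n [b bc ab]] := thread_seqP a (divr_gt0 e0 (ltr0Sn R 1)).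
exists (cls (AdmThread (coherent_admissible bc))); first by exists n => //; exists (AdmThread (coherent_admissible bc)).
rewrite rnorm_clsB (@le_lt_trans _ _ (e / 2))//; last by lra.
apply: tnorm_le; first by rewrite divr_ge0// ltW.
by exists n => l nl; rewrite threadBE; exact: ab.
Qed.

End AFLimit.

(** * Closures of subalgebras *)

Section Closure.
Context {R : realType} {A : cstarAlgType R}.
Local Notation C := R[i].

Lemma rnormM (x y : A) : rnorm (cmul x y) <= rnorm x * rnorm y.
Proof. by have := cnormM x y; rewrite !rnormE -rmorphM lecR. Qed.

Lemma cstarN (x : A) : cstar (- x) = - cstar x.
Proof. by rewrite -[- x]scaleN1r cstarZ rmorphN rmorph1 scaleN1r. Qed.

Lemma rnorm_cstar (x : A) : rnorm (cstar x) = rnorm x.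
Proof.
suff h (y : A) : rnorm y <= rnorm (cstar y).
  by apply/eqP; rewrite eq_le h -{2}[x]cstarK h.
apply: ler_of_sqr_le; first exact: rnorm_ge0.
have := cnorm_starM y; rewrite !rnormE -rmorphXn => /complexI <-.
by rewrite mulrC rnormM.
Qed.

Lemma cmul_sub (x x' y y' : A) :
  cmul x y - cmul x' y' = cmul (x - x') y + cmul x' (y - y').
Proof.
rewrite cmulDl cmulDr -[- x']scaleN1r -[- y']scaleN1r cmulZl cmulZr !scaleN1r.
by rewrite addrA subrK.
Qed.

Lemma cmul0 (x : A) : cmul 0 x = 0.
Proof. by rewrite -(scale0r (0 : A)) cmulZl !scale0r. Qed.

Lemma cmulx0 (x : A) : cmul x 0 = 0.
Proof. by rewrite -(scale0r (0 : A)) cmulZr !scale0r. Qed.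

Lemma closure_subalgebra (B : set A) : subalgebra B -> subalgebra (closure B).
Proof.
move=> [B0 BD BZ BM]; split.
- exact: subset_closure.
- move=> x y /closureNP xB /closureNP yB; apply/closureNP => e e0.
  have e2 : 0 < e / 2 by rewrite divr_gt0.
  have [a Ba xa] := xB _ e2; have [b Bb yb] := yB _ e2.
  exists (a + b); first exact: BD.
  rewrite opprD addrACA (le_lt_trans (rnormD _ _))//; lra.
- move=> c x /closureNP xB; apply/closureNP => e e0.
  have K0 : 0 < ComplexField.Normc.normc c + 1 by rewrite ltr_wpDl ?cabs_ge0.
  have [a Ba xa] := xB _ (divr_gt0 e0 K0).
  exists (c *: a); first exact: BZ.
  rewrite -scalerBr rnormZ; move: xa; rewrite ltr_pdivlMr//.
  by have := rnorm_ge0 (x - a); have := cabs_ge0 c; nra.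
- move=> x y /closureNP xB /closureNP yB; apply/closureNP => e e0.
  have K0 : 0 < rnorm x + rnorm y + 1.
    by rewrite ltr_wpDl// addr_ge0 ?rnorm_ge0.
  pose d := Num.min 1 (e / (rnorm x + rnorm y + 1)).
  have d0 : 0 < d by rewrite lt_min ltr01 divr_gt0.
  have d1 : d <= 1 by rewrite ge_min lexx.
  have de : d * (rnorm x + rnorm y + 1) <= e by rewrite -ler_pdivlMr// ge_min lexx orbT.
  have [a Ba xa] := xB _ d0; have [b Bb yb] := yB _ d0.
  exists (cmul a b); first exact: BM.
  rewrite cmul_sub (le_lt_trans (rnormD _ _))//.
  have h1 := rnormM (x - a) y; have h2 := rnormM a (y - b).
  have h3 : rnorm a <= rnorm x + rnorm (x - a).
    rewrite rnorm_distC -{1}[a](subrK x) addrC; exact: rnormD.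
  have := rnorm_ge0 y; have := rnorm_ge0 a; have := rnorm_ge0 (y - b); have := rnorm_ge0 (x - a).
  have := rnorm_ge0 x.
  move: h1 h2 h3 de xa yb.
  move: (rnorm (cmul _ _)) (rnorm (cmul _ _)) (rnorm a) (rnorm x) (rnorm y).
  move: (rnorm (x - a)) (rnorm (y - b)) => p q r s t u v.
  by move: d0 d1; clear; nra.
Qed.

Lemma closure_cstar (B : set A) : (forall x, B x -> closure B (cstar x)) ->
  forall x, closure B x -> closure B (cstar x).
Proof.
move=> BS x /closureNP xB; apply/closureNP => e e0.
have e2 : 0 < e / 2 by rewrite divr_gt0.
have [a Ba xa] := xB _ e2; have /closureNP/(_ _ e2)[b Bb ab] := BS a Ba.
exists b => //; rewrite -[cstar x](subrK (cstar a)) -addrA (le_lt_trans (rnormD _ _))//.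
by rewrite -cstarN -cstarD rnorm_cstar; lra.
Qed.

End Closure.

(** * Threads with summable defects *)

Section Summable.
Context {R : realType} {T : tower R}.

(** The prolongation of the entry at n stays within the sum of the defects above
    n, which is at most 2^-1 ^+ n. *)
Lemma admissible_summable (a : forall l, T l) :
  (forall l, lnorm (conn (a l) - a l.+1) <= 2^-1 ^+ l.+1) -> admissible a.
Proof.
move=> ha e e0; have [n ne] : exists n, 2^-1 ^+ n <= e.
  have [n ne] := invn_le e0; exists n; apply: le_trans ne.
  rewrite exprVn lef_pV2 ?posrE ?exprn_gt0 ?ltr0n// -natrX ler_nat.
  exact: ltn_expl.
exists n, (extend (a n)); first exact: extend_coherent.
have e20 : (0 : R) <= 2^-1 by rewrite invr_ge0.
suff h l : (n <= l)%N -> lnorm (a l - extend (a n) l) <= 2^-1 ^+ n - 2^-1 ^+ l.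
  move=> l nl; rewrite (le_trans (h l nl))// (le_trans _ ne)// gerBl.
  by rewrite exprn_ge0.
elim: l => [|l IH].
  by rewrite leqn0 => /eqP n0; rewrite n0 extend_id !subrr lnorm0.
rewrite leq_eqVlt => /predU1P[<-|]; first by rewrite extend_id !subrr lnorm0.
rewrite ltnS => nl; rewrite (extend_coherent (a n) nl).
rewrite (le_trans (lnorm_tri (conn (a l)) _ _))// lnorm_distC.
have -> : conn (a l) - conn (extend (a n) l) = conn (a l - extend (a n) l).
  by rewrite connD -[in RHS]scaleN1r connZ scaleN1r.
rewrite (le_trans (lerD (ha l) (le_trans (conn_le _) (IH nl))))//.
by rewrite exprS; lra.
Qed.
End Summable.

(** * Grids on the interval [-1, 1] *)

Section Grid.
Context {R : realType}.

Definition grid K (j : 'I_(2 * K).+1) : R := j%:R / K%:R - 1.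

(** Rounds t down to the grid of mesh K^-1; [inord] is harmless for t in [-1, 1],
    where the index is at most 2 * K. *)
Definition round K (t : R) : 'I_(2 * K).+1 := inord (Num.truncn ((t + 1) * K%:R)).

Lemma grid_round K t : (0 < K)%N -> `|t| <= 1 -> `|grid (round K t) - t| <= K%:R^-1.
Proof.
move=> K0; rewrite ler_norml => /andP[t1 t2].
have K0' : (0 : R) < K%:R by rewrite ltr0n.
have x0 : 0 <= (t + 1) * K%:R by rewrite mulr_ge0 ?ler0n//; lra.
have := truncn_itv x0; set j := Num.truncn _ => /andP[j1 j2].
have jK : (j < (2 * K).+1)%N.
  rewrite ltnS -(ler_nat R) (le_trans j1)// natrM ler_wpM2r ?ler0n//; lra.
rewrite /grid /round inordK// -/j.
have e1 : (t + 1) * K%:R / K%:R = t + 1 by rewrite mulfK// gt_eqF.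
have j1' : j%:R / K%:R <= t + 1 by rewrite -e1 ler_wpM2r// invr_ge0 ltW.
have j2' : t + 1 <= j%:R / K%:R + K%:R^-1.
  have -> : j%:R / K%:R + K%:R^-1 = j.+1%:R / K%:R :> R.
    by rewrite -addn1 natrD mulrDl mul1r.
  by rewrite -e1 ler_wpM2r ?invr_ge0 ?(ltW K0')// ltW.
rewrite ler_norml; lra.
Qed.

Lemma grid_max K : (0 < K)%N -> grid (ord_max : 'I_(2 * K).+1) = 1.
Proof.
move=> K0; rewrite /grid /= natrM mulfK ?pnatr_eq0 -?lt0n//; lra.
Qed.

Lemma grid_le1 K (j : 'I_(2 * K).+1) : (0 < K)%N -> `|grid j| <= 1.
Proof.
move=> K0; have K0' : (0 : R) < K%:R by rewrite ltr0n.
have j0 : 0 <= j%:R / K%:R :> R by rewrite divr_ge0 ?ler0n.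
have j2 : j%:R / K%:R <= 2 :> R.
  by rewrite ler_pdivrMr// -natrM ler_nat -ltnS ltn_ord.
by rewrite /grid ler_norml; lra.
Qed.
End Grid.

(** * The tower of matrix-valued functions on grids *)

(** The outcome of [almost_diagonal_nilpotent], packaged as data so that one such
    matrix can be chosen for every level. *)
Record almost_diagonal (R : realType) (e : R) := AlmostDiagonal {
  adim : nat;
  amx : 'M[R[i]]_adim.+1;
  aeig : 'I_adim.+1 -> R;
  acorner : 'I_adim.+1;
  amx_nil : amx ^+ adim.+1 = 0;
  amx_le1 : opnorm amx <= 1;
  amx_close : opnorm (amx - diag_mx (\row_i (aeig i)%:C)) <= e;
  aeig_le1 : forall i, `|aeig i| <= 1;
  amx_corner : 1 - e <= cabs (amx acorner acorner) }.

Lemma almost_diagonal_inhabited (R : realType) (e : R) : 0 < e -> almost_diagonal e.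
Proof.
move=> /almost_diagonal_nilpotent/cid[m /cid[Q /cid[l /cid[i [h1 h2 h3 h4 h5]]]]].
exact: (@AlmostDiagonal _ _ m Q l i).
Qed.

Section MatrixFunctions.
Context {R : realType} {L d : nat}.
Local Notation C := R[i].
Local Notation M := {ffun 'I_L -> 'M[C]_d}.
Implicit Types f g : M.

Definition ffmx_mul f g : M := [ffun y => f y *m g y].
Definition ffmx_star f : M := [ffun y => (f y) ^t*].
Definition ffmx_norm f : R := \big[Order.max/0]_y opnorm (f y).

Lemma ffmx_norm_le f c : 0 <= c -> (forall y, opnorm (f y) <= c) -> ffmx_norm f <= c.
Proof. by move=> c0 fc; apply/bigmax_leP. Qed.

Lemma le_ffmx_norm f y : opnorm (f y) <= ffmx_norm f.
Proof. exact: (le_bigmax _ (fun y => opnorm (f y))). Qed.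

Lemma ffmx_norm_ge0 f : 0 <= ffmx_norm f.
Proof. exact: bigmax_ge_id. Qed.

Lemma ffmx_normD f g : ffmx_norm (f + g) <= ffmx_norm f + ffmx_norm g.
Proof.
apply: ffmx_norm_le => [|y]; first by rewrite addr_ge0 ?ffmx_norm_ge0.
by rewrite ffunE (le_trans (opnormD _ _))// lerD ?le_ffmx_norm.
Qed.

Lemma ffmx_normZ_le c f : ffmx_norm (c *: f) <= cabs c * ffmx_norm f.
Proof.
apply: ffmx_norm_le => [|y]; first by rewrite mulr_ge0 ?cabs_ge0 ?ffmx_norm_ge0.
by rewrite ffunE opnormZ ler_wpM2l ?cabs_ge0 ?le_ffmx_norm.
Qed.

Lemma ffmx_normZ c f : ffmx_norm (c *: f) = cabs c * ffmx_norm f.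
Proof.
apply: (homogeneity_of_le (scale := fun c (g : M) => c *: g)).
- exact: ffmx_norm_ge0.
- exact: ffmx_normZ_le.
- by move=> k g k0; rewrite scalerA mulVf// scale1r.
Qed.

Lemma ffmx_normM f g : ffmx_norm (ffmx_mul f g) <= ffmx_norm f * ffmx_norm g.
Proof.
apply: ffmx_norm_le => [|y]; first by rewrite mulr_ge0 ?ffmx_norm_ge0.
by rewrite ffunE (le_trans (opnormM _ _))// ler_pM ?opnorm_ge0 ?le_ffmx_norm.
Qed.

Lemma ffmx_norm_starM f : ffmx_norm (ffmx_mul (ffmx_star f) f) = ffmx_norm f ^+ 2.
Proof.
apply/eqP; rewrite eq_le; apply/andP; split.
  apply: ffmx_norm_le => [|y]; first by rewrite sqr_ge0.
  by rewrite !ffunE opnorm_cstar ler_pXn2r ?nnegrE ?opnorm_ge0 ?ffmx_norm_ge0 ?le_ffmx_norm.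
rewrite -[leRHS]sqr_sqrtr ?ffmx_norm_ge0// ler_pXn2r ?nnegrE ?ffmx_norm_ge0 ?sqrtr_ge0//.
apply: ffmx_norm_le => [|y]; first exact: sqrtr_ge0.
rewrite -(@ler_pXn2r _ 2)// ?nnegrE ?opnorm_ge0 ?sqrtr_ge0// sqr_sqrtr ?ffmx_norm_ge0//.
by have := le_ffmx_norm (ffmx_mul (ffmx_star f) f) y; rewrite !ffunE opnorm_cstar.
Qed.

(** The matrix units placed at single points span. *)
Lemma ffmx_spanned : exists (n : nat) (v : 'I_n -> M),
  forall f, exists c : 'I_n -> C, f = \sum_(i < n) c i *: v i.
Proof.
pose I := ('I_L * ('I_d * 'I_d))%type.
pose e (p : I) : M := [ffun y => if y == p.1 then delta_mx p.2.1 p.2.2 else 0].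
exists #|{: I}|, (fun i => e (enum_val i)) => f.
exists (fun i => let p := enum_val i in f p.1 p.2.1 p.2.2).
rewrite -(@reindex _ _ _ _ _ _ (fun=> true) (fun p : I => f p.1 p.2.1 p.2.2 *: e p)) /=; last first.
  by apply: onW_bij; exact: enum_val_bij.
apply/ffunP => y; rewrite sum_ffunE -(pair_big predT predT (fun y' ij => (f y' ij.1 ij.2 *: e (y', ij)) y)) /=.
rewrite (bigD1 y)//= [X in _ + X]big1 ?addr0 => [|y' y'y]; last first.
  by rewrite big1// => ij _; rewrite !ffunE /= eq_sym (negbTE y'y) scaler0.
rewrite {1}[f y]matrix_sum_delta pair_big /=.
by apply: eq_bigr => ij _; rewrite !ffunE /= eqxx.
Qed.

End MatrixFunctions.

Section Construction.
Context {R : realType}.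
Local Notation C := R[i].
Context (q : forall l, almost_diagonal (2^-1 ^+ l.+2 : R)).

Let m l := (adim (q l)).+1.
Let Q l : 'M[C]_(m l) := amx (q l).

Fixpoint tdim l : nat := if l is l'.+1 then (tdim l' * m l')%N else 1%N.

Definition mesh l := (2 ^ l.+2)%N.

Lemma mesh_gt0 l : (0 < mesh l)%N. Proof. by rewrite expn_gt0. Qed.

Lemma meshV l : (mesh l)%:R^-1 = 2^-1 ^+ l.+2 :> R.
Proof. by rewrite /mesh natrX exprVn. Qed.

(** The level l stands for the functions from [-1, 1] to the tensor product of the
    first l matrix algebras; the interval is replaced by a grid to make it
    finite-dimensional. *)
Definition grid_level l := {ffun 'I_(2 * mesh l).+1 -> 'M[C]_(tdim l)}.

(** The grid point of level l next to the eigenvalue i times the point y. *)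
Definition rescale l (i : 'I_(m l)) (y : 'I_(2 * mesh l.+1).+1) : 'I_(2 * mesh l).+1 :=
  round (mesh l) (aeig i * grid y).

(** Up to rounding, the function f goes to y |-> f (y times Lambda), where Lambda is
    the diagonal matrix of the eigenvalues of level l: the coordinate function y
    goes to y tensored with Lambda. *)
Definition grid_conn l (f : grid_level l) : grid_level l.+1 :=
  [ffun y => blockdiag (fun i => f (rescale i y))].

Lemma grid_conn_le l (f : grid_level l) : ffmx_norm (grid_conn f) <= ffmx_norm f.
Proof.
apply: ffmx_norm_le => [|y]; first exact: ffmx_norm_ge0.
rewrite ffunE; apply: opnorm_blockdiag => [|i]; first exact: ffmx_norm_ge0.
exact: le_ffmx_norm.
Qed.

Definition grid_tower : tower R.
refine (@Tower R grid_level (fun l => ffmx_mul) (fun l => ffmx_star) (fun l => ffmx_norm) grid_conn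
  _ _ _ _ _ _ _ _ _ (fun l => ffmx_normD) (fun l => ffmx_normZ) (fun l => ffmx_normM)
  (fun l => ffmx_norm_starM) _ _ _ _ grid_conn_le (fun l => ffmx_spanned)).
- by move=> l x y z; apply/ffunP => i; rewrite !ffunE mulmxA.
- by move=> l x y z; apply/ffunP => i; rewrite !ffunE mulmxDl.
- by move=> l x y z; apply/ffunP => i; rewrite !ffunE mulmxDr.
- by move=> l c x y; apply/ffunP => i; rewrite !ffunE scalemxAl.
- by move=> l c x y; apply/ffunP => i; rewrite !ffunE scalemxAr.
- by move=> l x; apply/ffunP => i; rewrite !ffunE trmxCK.
- by move=> l x y; apply/ffunP => i; rewrite !ffunE adjmxD.
- by move=> l c x; apply/ffunP => i; rewrite !ffunE adjmxZ.
- by move=> l x y; apply/ffunP => i; rewrite !ffunE adjmxM.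
- move=> l x y; apply/ffunP => i; rewrite !ffunE -blockdiagD.
  by apply: eq_bigr => j _; rewrite ffunE.
- move=> l c x; apply/ffunP => i; rewrite !ffunE -blockdiagZ.
  by apply: eq_bigr => j _; rewrite ffunE.
- move=> l x y; apply/ffunP => i; rewrite !ffunE -blockdiagM.
  by apply: eq_bigr => j _; rewrite ffunE.
- move=> l x; apply/ffunP => i; rewrite !ffunE -blockdiag_adj.
  by apply: eq_bigr => j _; rewrite ffunE.
Defined.

Local Notation A := (tower_limit grid_tower).

(** * The generators *)

(** Since Lambda is self-adjoint, [factor_close] holds for Q and for its adjoint
    alike. *)
Definition factor (b : bool) l : 'M[C]_(m l) := if b then (Q l) ^t* else Q l.

Fixpoint ptens (S : seq bool) l : 'M[C]_(tdim l) :=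
  if l is l'.+1 then ptens S l' *t factor (nth false S l') l' else 1%:M.

Let eps l : R := 2^-1 ^+ l.+2.
Lemma epsD l : eps l + eps l = 2^-1 ^+ l.+1.
Proof. by rewrite /eps [2^-1 ^+ l.+2]exprS; move: (2^-1 ^+ _) => u; lra. Qed.

Let eig l : 'M[C]_(m l) := diag_mx (\row_i (aeig i)%:C).

Lemma eig_adj l : (eig l) ^t* = eig l.
Proof.
rewrite /eig tr_diag_mx map_diag_mx; congr diag_mx; apply/rowP => i.
by rewrite !mxE /= conj_Creal// complex_real.
Qed.

Lemma factor_close b l : opnorm (factor b l - eig l) <= eps l.
Proof.
rewrite /factor; case: b; last exact: amx_close.
have -> : (Q l) ^t* - eig l = (Q l - eig l) ^t*.
  by rewrite -{1}eig_adj linearB /= map_mxB.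
by rewrite opnorm_adj; exact: amx_close.
Qed.

Lemma factor_le1 b l : opnorm (factor b l) <= 1.
Proof. by rewrite /factor; case: b; rewrite ?opnorm_adj; exact: amx_le1. Qed.

Lemma ptens_le1 S l : opnorm (ptens S l) <= 1.
Proof.
elim: l => [|l IH] /=.
  by apply: opnorm_coisometry; rewrite trmx1 map_mx1 mulmx1.
rewrite (le_trans (opnorm_tens _ _))// -[leRHS]mulr1.
by rewrite ler_pM ?opnorm_ge0 ?factor_le1.
Qed.

(** The truncation at level l of the generator y (x) Q_0 (x) Q_1 (x) ..., with Q_j
    replaced by its adjoint for the j in the finite set that S encodes: positions
    beyond the end of the list S are not in the set. *)
Definition gen_seq (S : seq bool) l : grid_tower l :=
  [ffun y => (grid y)%:C *: ptens S l].

(** The connecting map tensors the truncation with Lambda instead of the next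
    factor Q; that costs the distance from Q to Lambda, plus one rounding error. *)
Lemma gen_seq_defect S l : lnorm (conn (gen_seq S l) - gen_seq S l.+1) <= 2^-1 ^+ l.+1.
Proof.
have e0 : 0 <= eps l by rewrite exprn_ge0// invr_ge0.
apply: ffmx_norm_le => [|y]; first by rewrite exprn_ge0// invr_ge0.
rewrite !ffunE /=; set X := ptens S l; set b := nth _ _ _.
pose c (i : 'I_(m l)) : C := (grid (rescale i y))%:C.
have -> : blockdiag (fun i => gen_seq S l (rescale i y)) = X *t diag_mx (\row_i c i).
  by rewrite -blockdiag_tens; apply: eq_bigr => i _; rewrite ffunE.
(* dif collects the rounding errors; the rest is the error of factor against eig. *)
pose dif : 'M[C]_(m l) := diag_mx (\row_i (c i - (grid y)%:C * (aeig i)%:C)).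
have -> : X *t diag_mx (\row_i c i) - (grid y)%:C *: (X *t factor b l) =
    X *t (dif + (- (grid y)%:C) *: (factor b l - eig l)).
  have -> : diag_mx (\row_i c i) = dif + (grid y)%:C *: eig l.
    rewrite /dif /eig -linearZ -linearD; congr diag_mx.
    by apply/rowP => i; rewrite !mxE subrK.
  rewrite -scaleNr -tensmxZr -tensmxDr; congr (_ *t _).
  by rewrite scalerBr scaleNr [in RHS]scaleNr opprK -addrA [_ *: eig l + _]addrC.
rewrite (le_trans (opnorm_tens _ _))// -[leRHS]mul1r.
rewrite ler_pM ?opnorm_ge0 ?ptens_le1// (le_trans (opnormD _ _))//.
rewrite -epsD.
rewrite lerD//.
  apply: opnorm_diag => // i; rewrite mxE /c -rmorphM -rmorphB cabs_real.
  rewrite [X in _ - X]mulrC [leRHS](esym (meshV l)).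
  apply: grid_round; first exact: mesh_gt0.
  by rewrite normrM mulr_ile1 ?normr_ge0// ?aeig_le1// grid_le1// mesh_gt0.
rewrite opnormZ cabsN cabs_real -[leRHS]mul1r ler_pM ?opnorm_ge0 ?factor_close//.
by rewrite grid_le1// mesh_gt0.
Qed.

Definition gen_thread S : adm_thread grid_tower :=
  AdmThread (admissible_summable (gen_seq_defect S)).

Fixpoint corner l : 'I_(tdim l) :=
  if l is l'.+1 then mxtens_index (corner l', acorner (q l')) else ord0.

Lemma dyadic_step (a u : R) : (a - 2 * u) * 1 + 1 * u <= a - u.
Proof. by lra. Qed.

Lemma corner_step (e x y : R) : 0 < e -> e <= 4^-1 ->
  2^-1 + (e + e) <= x -> 1 - e <= y -> 2^-1 + e <= x * y.
Proof. by move=> *; nra. Qed.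

(** The product of the factors 1 - 2^-1 ^+ l.+2 stays above 1 / 2; the second
    summand keeps the induction going. *)
Lemma ptens_corner l : 2^-1 + 2^-1 ^+ l.+1 <= cabs (ptens [::] l (corner l) (corner l)).
Proof.
elim: l => [|l IH] /=.
  by rewrite mxE cabs1 expr1; lra.
rewrite tensmxE cabsM nth_nil /factor.
have u0 : 0 < eps l by rewrite exprn_gt0// invr_gt0.
have u4 : eps l <= 4^-1.
  have : (2^-1 : R) ^+ l <= 1 by apply: exprn_ile1; lra.
  by rewrite /eps !exprS; move: (2^-1 ^+ l) => u; lra.
have := amx_corner (q l); rewrite -/(eps l) -/(Q l).
by rewrite -epsD in IH; exact: corner_step.
Qed.

Lemma gen_thread_neq0 : cls (gen_thread [::]) != 0.
Proof.
apply/eqP => z0; have : tnorm (gen_thread [::]) = 0.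
  by apply: complexI; rewrite -cls_norm z0 normr0.
move=> t0; have [|n h] := @tnorm_lt _ _ (gen_thread [::]) 4^-1; first by rewrite t0 invr_gt0.
have := h n (leqnn n); have := le_ffmx_norm (gen_seq [::] n) ord_max.
rewrite ffunE grid_max ?mesh_gt0// scale1r => h1 h2.
have h3 := le_opnorm (ptens [::] n) (corner n) (corner n).
have := le_trans (ptens_corner n) (le_trans h3 (le_trans h1 h2)).
have : 0 < 2^-1 ^+ n.+1 :> R by rewrite exprn_gt0// invr_gt0.
by move: (2^-1 ^+ n.+1) => u; lra.
Qed.

(** * Words in the generators and the nil algebra *)

(** Words are nonempty, and therefore given by a first letter S and the list w of the
    remaining ones. *)
Fixpoint word_thread (S : seq bool) (w : seq (seq bool)) : adm_thread grid_tower :=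
  if w is S' :: w' then threadM (gen_thread S) (word_thread S' w') else gen_thread S.

Definition wtens (w : seq (seq bool)) l : 'M[C]_(tdim l) :=
  foldr (fun S M => ptens S l *m M) 1%:M w.

Definition wfactor (w : seq (seq bool)) l : 'M[C]_(m l) :=
  foldr (fun S M => factor (nth false S l) l *m M) 1%:M w.

Lemma tensmx11 a b : (1%:M : 'M[C]_a) *t (1%:M : 'M[C]_b) = 1%:M.
Proof.
apply/matrixP => i j; case: (mxtens_indexP i) => i0 i1.
case: (mxtens_indexP j) => j0 j1; rewrite tensmxE !mxE.
by rewrite (can_eq (@mxtens_indexK a b)) xpair_eqE -natrM mulnb.
Qed.

Lemma wtensS w l : wtens w l.+1 = wtens w l *t wfactor w l.
Proof.
elim: w => [|S w IH] /=; first by rewrite tensmx11.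
by rewrite IH tensmx_mul.
Qed.

Lemma word_threadE S w l y :
  word_thread S w l y = (grid y)%:C ^+ (size w).+1 *: wtens (S :: w) l.
Proof.
elim: w S => [|S' w IH] S; first by rewrite /= ffunE mulmx1 expr1.
rewrite [LHS]ffunE IH /= ffunE -scalemxAl -scalemxAr scalerA -exprS.
by [].
Qed.

Lemma wfactor_id w l : all (fun S => size S <= l)%N w -> wfactor w l = Q l ^+ size w.
Proof.
elim: w => [|S w IH] //= /andP[Sl wl].
by rewrite IH// nth_default// exprS.
Qed.

(** In position k all letters have the factor Q k, so a word of length r has the
    factor Q k ^+ r there, which is 0 as soon as r reaches the size of Q k. *)
Lemma long_word_eq0 k S w : all (fun S => size S <= k)%N (S :: w) -> (m k <= (size w).+1)%N ->
  cls (word_thread S w) = 0.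
Proof.
move=> Sw mw; rewrite -cls0; apply: (@cls_eventually_eq _ _ k.+1) => l kl.
suff W : wtens (S :: w) l = 0.
  by apply/ffunP => y; rewrite word_threadE ffunE W scaler0.
elim: l kl => [|l IH]; first by rewrite ltn0.
rewrite ltnS leq_eqVlt wtensS => /predU1P[<-|/IH ->]; last exact: tens0mx.
rewrite wfactor_id// -[size (S :: w)](subnK mw) exprD.
by rewrite /Q amx_nil mulr0 tensmx0.
Qed.

Lemma word_cat S w S' w' : cmul (cls (word_thread S w)) (cls (word_thread S' w')) =
  cls (word_thread S (w ++ S' :: w')).
Proof.
elim: w S => [|S2 w IH] S; first by rewrite -clsM.
by rewrite /= clsM -cmulA IH -clsM.
Qed.

(** The span of the words of length at least r in the letters supported in
    {0, ..., k - 1}. The length is tracked because the n-th power of an element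
    built from such words only involves words of length at least n. *)
Inductive wspan (k r : nat) : A -> Prop :=
| wspan0 : wspan k r 0
| wspanD c S w x : (r <= (size w).+1)%N -> all (fun S => size S <= k)%N (S :: w) ->
    wspan k r x -> wspan k r (c *: cls (word_thread S w) + x).

Lemma wspan_add k r x y : wspan k r x -> wspan k r y -> wspan k r (x + y).
Proof.
move=> kx ky; elim: kx => [|c S w z rw Sw _ IH]; first by rewrite add0r.
by rewrite -addrA; exact: wspanD.
Qed.

Lemma wspan_scale k r c x : wspan k r x -> wspan k r (c *: x).
Proof.
elim=> [|d S w z rw Sw _ IH]; first by rewrite scaler0; exact: wspan0.
by rewrite scalerDr scalerA; exact: wspanD.
Qed.

Lemma wspanW k r k' r' x : (k <= k')%N -> (r' <= r)%N -> wspan k r x -> wspan k' r' x.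
Proof.
move=> kk rr; elim=> [|d S w z rw Sw _ IH]; first exact: wspan0.
apply: wspanD => //; first exact: leq_trans rw.
by apply: sub_all Sw => S' /= /leq_trans; apply.
Qed.

Lemma wspan_mul k r s x y : wspan k r x -> wspan k s y -> wspan k (r + s) (cmul x y).
Proof.
move=> kx ky; elim: kx => [|c S w z rw Sw _ IH]; first by rewrite cmul0; exact: wspan0.
rewrite cmulDl; apply: wspan_add => //; rewrite cmulZl; apply: wspan_scale.
elim: ky => [|d S' w' z' sw Sw' _ IH']; first by rewrite cmulx0; exact: wspan0.
rewrite cmulDr cmulZr word_cat; apply: wspanD => //.
  by rewrite size_cat -addSn leq_add.
by rewrite -[S :: (w ++ _)]/((S :: w) ++ (S' :: w')) all_cat Sw Sw'.
Qed.

Lemma wspan_dim_eq0 k x : wspan k (m k) x -> x = 0.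
Proof.
by elim=> [//|c S w z rw Sw _ ->]; rewrite (long_word_eq0 Sw rw) scaler0 addr0.
Qed.

Definition nil_alg : set A := [set x | exists k, wspan k 1 x].

Lemma nil_alg_subalgebra : subalgebra nil_alg.
Proof.
have mx x y : nil_alg x -> nil_alg y -> exists k, wspan k 1 x /\ wspan k 1 y.
  move=> [k kx] [l ly]; exists (maxn k l).
  by split; [apply: wspanW kx|apply: wspanW ly]; rewrite ?leq_maxl ?leq_maxr.
split.
- by exists 0%N; exact: wspan0.
- by move=> x y nx /(mx _ _ nx)[k [kx ky]]; exists k; exact: wspan_add.
- by move=> c x [k kx]; exists k; exact: wspan_scale.
- move=> x y nx /(mx _ _ nx)[k [kx ky]]; exists k.
  exact: wspanW (wspan_mul kx ky).
Qed.

Lemma nil_alg_nilpotent x : nil_alg x -> nilpotent_elt x.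
Proof.
move=> [k kx]; exists (adim (q k)); apply: (@wspan_dim_eq0 k).
rewrite /m; elim: (adim _) => [//|n IH].
by rewrite iterS -[n.+2]add1n; exact: wspan_mul.
Qed.

(** The complement in {0, ..., n - 1}. *)
Definition flip n (S : seq bool) : seq bool := mkseq (fun i => ~~ nth false S i) n.

(** Below n the factors of the adjoint and of the flipped generator coincide. From n
    on they are Q^* and Q, which are close to each other because both are close to
    Lambda, and the distances add up to at most 2^-1 ^+ n. *)
Lemma ptens_flip n S l : (size S <= n)%N ->
  opnorm ((ptens S l) ^t* - ptens (flip n S) l) <= 2^-1 ^+ n.
Proof.
move=> Sn.
have low j : (j <= n)%N -> (ptens S j) ^t* = ptens (flip n S) j.
  elim: j => [|j IH] jn /=; first by rewrite trmx1 map_mx1.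
  rewrite adjmx_tens IH ?(ltnW jn)//; congr (_ *t _).
  by rewrite nth_mkseq// /factor; case: nth; rewrite ?trmxCK.
have [ln|nl] := leqP l n.
  by rewrite low// subrr opnorm0 exprn_ge0// invr_ge0.
suff h : opnorm ((ptens S l) ^t* - ptens (flip n S) l) <= 2^-1 ^+ n - 2^-1 ^+ l.
  by rewrite (le_trans h)// gerBl exprn_ge0// invr_ge0.
elim: l {nl} (ltnW nl) => [|l IH].
  by rewrite leqn0 => /eqP n0; rewrite low ?n0// !subrr opnorm0.
rewrite leq_eqVlt => /predU1P[ln|].
  by rewrite low ?ln// !subrr opnorm0.
rewrite ltnS => nl /=; rewrite adjmx_tens !nth_default ?size_mkseq ?(leq_trans Sn)//.
have -> : (ptens S l) ^t* *t (factor false l) ^t* - ptens (flip n S) l *t factor false l =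
   ((ptens S l) ^t* - ptens (flip n S) l) *t (factor false l) ^t* +
   ptens (flip n S) l *t (factor true l - factor false l).
  apply/matrixP => i j; rewrite !mxE /factor; ring.
rewrite (le_trans (opnormD _ _))//.
have ff : opnorm (factor true l - factor false l) <= 2^-1 ^+ l.+1.
  have -> : factor true l - factor false l =
      (factor true l - eig l) + (-1) *: (factor false l - eig l).
    by rewrite scaleN1r opprB addrA subrK.
  rewrite (le_trans (opnormD _ _))// opnormZ cabsN cabs1 mul1r.
  rewrite -epsD.
  by rewrite lerD ?factor_close.
have h1 := opnorm_tens ((ptens S l) ^t* - ptens (flip n S) l) ((factor false l) ^t*).
have h2 := opnorm_tens (ptens (flip n S) l) (factor true l - factor false l).
have h3 := factor_le1 false l; rewrite -opnorm_adj in h3.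
have h4 := ptens_le1 (flip n S) l.
have h5 : 2^-1 ^+ l = 2 * 2^-1 ^+ l.+1 :> R by rewrite exprS; field.
have h6 := ler_pM (opnorm_ge0 _) (opnorm_ge0 _) (IH nl) h3.
have h7 := ler_pM (opnorm_ge0 _) (opnorm_ge0 _) h4 ff.
rewrite (le_trans (lerD (le_trans h1 h6) (le_trans h2 h7)))// h5.
exact: dyadic_step.
Qed.

Lemma cstar_gen_closure S : closure nil_alg (cstar (cls (gen_thread S))).
Proof.
apply/closureNP => e e0.
have [k ke] := invn_le (divr_gt0 e0 (ltr0Sn R 1)).
pose n := maxn (size S) k.
have ne : 2^-1 ^+ n <= e / 2.
  apply: le_trans ke; rewrite exprVn lef_pV2 ?posrE ?exprn_gt0 ?ltr0n// -natrX ler_nat.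
  by rewrite (leq_ltn_trans (leq_maxr (size S) k))// ltn_expl.
exists (cls (gen_thread (flip n S))).
  exists n; rewrite -[cls _]addr0 -[cls _]scale1r.
  by apply: (@wspanD n 1 1 (flip n S) [::]); [|rewrite /= size_mkseq leqnn|exact: wspan0].
rewrite -clsS rnorm_clsB (@le_lt_trans _ _ (e / 2))//; last by lra.
apply: tnorm_le; first by rewrite divr_ge0// ltW.
exists 0%N => l _; rewrite threadBE; apply: ffmx_norm_le => [|y]; first by rewrite divr_ge0// ltW.
have -> : (lstar (gen_seq S l) - gen_seq (flip n S) l) y =
    (grid y)%:C *: ((ptens S l) ^t* - ptens (flip n S) l).
  rewrite !ffunE adjmxZ scalerBr conj_Creal ?complex_real//.
rewrite opnormZ cabs_real (le_trans _ ne)// -[leRHS]mul1r.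
by rewrite ler_pM ?opnorm_ge0 ?ptens_flip ?leq_maxl ?grid_le1 ?mesh_gt0.
Qed.

(** The adjoint of a word is the product of the adjoints of its letters, and the
    closure of the nil algebra is a subalgebra. *)
Lemma cstar_nil_alg_closure x : nil_alg x -> closure nil_alg (cstar x).
Proof.
have [D0 DD DZ DM] := closure_subalgebra nil_alg_subalgebra.
move=> [k]; elim=> [|c S w z _ _ _ IH].
  by rewrite -(scale0r (0 : A)) cstarZ rmorph0 !scale0r.
rewrite cstarD cstarZ; apply: DD => //; apply: DZ.
elim: w S => [|S' w IHw] S; first exact: cstar_gen_closure.
by rewrite /= clsM cstarM; apply: DM => //; exact: cstar_gen_closure.
Qed.

Lemma nil_alg_neq0 : exists2 x : A, closure nil_alg x & x != 0.
Proof.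
exists (cls (gen_thread [::])); last exact: gen_thread_neq0.
apply: subset_closure; exists 0%N; rewrite -[cls _]addr0 -[cls _]scale1r.
by apply: (@wspanD 0 1 1 [::] [::]) => //; exact: wspan0.
Qed.

End Construction.

Theorem proposition4p10 (R : realType) :
  exists (A : cstarAlgType R) (D : set A),
    [/\ AF A,
        cstar_subalgebra D,
        exists2 x : A, D x & x != 0 &
        exists N : set A,
          [/\ subalgebra N,
              dense_in N D &
              forall x : A, N x -> nilpotent_elt x]].
Proof.
have e0 l : 0 < 2^-1 ^+ l.+2 :> R by rewrite exprn_gt0// invr_gt0.
pose q l := almost_diagonal_inhabited (e0 l).
exists (tower_limit (grid_tower q) : cstarAlgType R), (closure (@nil_alg R q)); split.
- exact: tower_limit_AF.
- split; [exact: closure_subalgebra (@nil_alg_subalgebra R q)|exact: closed_closure|].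
  by apply: closure_cstar; exact: cstar_nil_alg_closure.
- exact: nil_alg_neq0.
- exists (@nil_alg R q); split; [exact: nil_alg_subalgebra| |exact: nil_alg_nilpotent].
  by split; [exact: subset_closure|].
Qed.
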